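(* The Cannon automaton $\mathcal A(W,S)$ of a Fuchsian Coxeter system $(W,S)$ is strongly connected.
   Context: A Coxeter system $(W,S)$ ($S$ finite) is $W=\langle S\mid s^2=1,\ (st)^{m_{st}}=1\ (s\neq t)\rangle$ with $m_{st}=m_{ts}\in\{2,3,\dots\}\cup\{\infty\}$ (no relation between $s,t$ if $m_{st}=\infty$). $\ell$ denotes word length with respect to $S$ and $d(u,v)=\ell(u^{-1}v)$. $(W,S)$ is Fuchsian if $S=\{s_1,\dots,s_n\}$ with $n\ge 3$ and there are integers $k_1,\dots,k_n\ge2$ with $\sum_{i=1}^n\frac1{k_i}<n-2$ such that, with indices read cyclically ($n+1\equiv1$), $m_{s_is_{i+1}}=k_i$ and $m_{s_is_j}=\infty$ whenever $i\ne j$ are not cyclically adjacent. For $w\in W$ the cone is $C_W(w)=\{v\in W: d(1,v)=d(1,w)+d(w,v)\}$ and its cone type is $T_W(w)=w^{-1}C_W(w)$. Let $\mathcal T(W,S)$ be the (finite) set of cone types. The Cannon automaton $\mathcal A(W,S)$ is the directed graph with vertex set $\mathcal T(W,S)$ and an edge labelled $s\in S$ from $\mathbf T$ to $\mathbf T'$ iff there is $w\in W$ with $\mathbf T=T_W(w)$, $\mathbf T'=T_W(ws)$ and $d(1,ws)=d(1,w)+1$. Write $\mathbf T\to\mathbf T'$ ($\mathbf T'$ is accessible from $\mathbf T$) if there is a directed path (with at least one edge) from $\mathbf T$ to $\mathbf T'$. A cone type $\mathbf T$ is recurrent if $\mathbf T\to\mathbf T$; the recurrent cone types induce a directed subgraph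 $\mathcal A_R(W,S)$. The automaton is strongly connected if each recurrent cone type is accessible from any other recurrent cone type in the subgraph $\mathcal A_R(W,S)$. *)

(* Defs.v *)
From mathcomp Require Import all_boot all_order all_algebra.
From mathcomp Require Import classical_sets.
From Stdlib Require Import Relation_Operators.

Set Implicit Arguments.
Unset Strict Implicit.
Unset Printing Implicit Defensive.

Import Order.TTheory GRing.Theory Num.Theory.

Local Open Scope classical_set_scope.

(* [None] encodes m_st = oo. Only the entries with s != t are meaningful; the
   diagonal is left unconstrained and never used. *)
Record coxeter_matrix (S : finType) := CoxeterMatrix {
  cox_m :> S -> S -> option nat;
  cox_m_sym : forall s t : S, cox_m s t = cox_m t s;
  cox_m_ge2 : forall (s t : S) (k : nat),
    s != t -> cox_m s t = Some k -> 2 <= k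
}.

Inductive coxeter_relator (S : finType) (m : coxeter_matrix S) :
    seq S -> Prop :=
| relator_square (s : S) : coxeter_relator m [:: s; s]
| relator_braid (s t : S) (k : nat) :
    s != t -> m s t = Some k ->
    coxeter_relator m (flatten (nseq k [:: s; t])).

(* The congruence on words generated by the relators. Since the relators s s
   make every letter its own inverse, the quotient of the free monoid on S by
   this congruence is the group presented by S and the relators. *)
Inductive coxeter_equiv (S : finType) (m : coxeter_matrix S) :
    seq S -> seq S -> Prop :=
| coxeter_equiv_relator (r : seq S) :
    coxeter_relator m r -> coxeter_equiv m r [::]
| coxeter_equiv_refl (u : seq S) : coxeter_equiv m u u
| coxeter_equiv_sym (u v : seq S) : coxeter_equiv m u v -> coxeter_equiv m v u
| coxeter_equiv_trans (u v w : seq S) :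
    coxeter_equiv m u v -> coxeter_equiv m v w -> coxeter_equiv m u w
| coxeter_equiv_cat (u u' v v' : seq S) :
    coxeter_equiv m u u' -> coxeter_equiv m v v' ->
    coxeter_equiv m (u ++ v) (u' ++ v').

Definition word_prod (S : finType) (W : groupType) (gen : S -> W)
  (u : seq S) : W := (\prod_(s <- u) gen s)%g.

(* W = < S | s^2 = 1, (st)^(m s t) = 1 > via gen: the fields say that
   evaluation induces a bijection from words modulo [coxeter_equiv] to W. *)
Record coxeter_system (S : finType) (m : coxeter_matrix S) (W : groupType) :=
  CoxeterSystem {
    cox_gen :> S -> W;
    cox_generates : forall w : W, exists u : seq S, word_prod cox_gen u = w;
    cox_presents : forall u v : seq S,
      word_prod cox_gen u = word_prod cox_gen v <-> coxeter_equiv m u v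
  }.

Lemma cox_has_length (S : finType) (m : coxeter_matrix S) (W : groupType)
    (c : coxeter_system m W) (w : W) :
  exists k : nat, [exists u : k.-tuple S, word_prod c u == w].
Proof.
have [u <-] := cox_generates c w.
by exists (size u); apply/existsP; exists (in_tuple u).
Qed.

Definition cox_length (S : finType) (m : coxeter_matrix S) (W : groupType)
  (c : coxeter_system m W) (w : W) : nat := ex_minn (cox_has_length c w).

Definition cox_dist (S : finType) (m : coxeter_matrix S) (W : groupType)
  (c : coxeter_system m W) (u v : W) : nat := cox_length c (u^-1 * v)%g.

Definition cone (S : finType) (m : coxeter_matrix S) (W : groupType)
  (c : coxeter_system m W) (w : W) : set W :=
  [set v | cox_dist c 1%g v = cox_dist c 1%g w + cox_dist c w v].

Definition cone_type (S : finType) (m : coxeter_matrix S) (W : groupType)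
  (c : coxeter_system m W) (w : W) : set W :=
  [set (w^-1 * v)%g | v in cone c w].

Record labelled_digraph (L V : Type) := LabelledDigraph {
  vertices : set V;
  edge : L -> V -> V -> Prop
}.

Definition accessible (L V : Type) (G : labelled_digraph L V) : V -> V -> Prop :=
  clos_trans V (fun x y => exists l : L, edge G l x y).

Definition recurrent (L V : Type) (G : labelled_digraph L V) : set V :=
  [set x | vertices G x /\ accessible G x x].

Definition induced_subgraph (L V : Type) (G : labelled_digraph L V)
  (A : set V) : labelled_digraph L V :=
  LabelledDigraph (vertices G `&` A)
    (fun l x y => [/\ edge G l x y, A x & A y]).

Definition recurrent_subgraph (L V : Type) (G : labelled_digraph L V) :
  labelled_digraph L V := induced_subgraph G (recurrent G).

(* Strong connectedness of an automaton only concerns its recurrent vertices,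
   and the connecting paths must stay inside the recurrent subgraph. *)
Definition strongly_connected (L V : Type) (G : labelled_digraph L V) : Prop :=
  forall x y : V, recurrent G x -> recurrent G y -> x <> y ->
    accessible (recurrent_subgraph G) x y.

Definition cannon_automaton (S : finType) (m : coxeter_matrix S)
  (W : groupType) (c : coxeter_system m W) : labelled_digraph S (set W) :=
  LabelledDigraph (range (cone_type c))
    (fun (s : S) (T T' : set W) => exists w : W,
       [/\ T = cone_type c w, T' = cone_type c (w * c s)%g
         & cox_dist c 1%g (w * c s)%g = (cox_dist c 1%g w).+1]).

(* [ordS i] is the cyclic successor of i : 'I_n. *)
Definition fuchsian (S : finType) (m : coxeter_matrix S) : Prop :=
  exists (n : nat) (e : 'I_n -> S) (k : 'I_n -> nat),
    [/\ 3 <= n /\ bijective e,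
        forall i : 'I_n, 2 <= k i,
        (\sum_(i < n) (k i)%:R^-1 < n%:R - 2 :> rat)%R,
        forall i : 'I_n, m (e i) (e (ordS i)) = Some (k i)
      & forall i j : 'I_n, i != j -> j != ordS i -> i != ordS j ->
          m (e i) (e j) = None].

(* Main.v *)
Require Import Defs.
From mathcomp Require Import all_boot all_order all_algebra.
From mathcomp Require Import boolp classical_sets functions reals Rstruct.
From mathcomp Require Import topology normedtype trigo.
From mathcomp Require Import zify ring lra.
From Stdlib Require Import Relation_Operators.

(** The group acts on the hyperbolic plane by reflections in the sides of a
    compact polygon with angles pi / k_i, and elements of the group are the
    chambers of the resulting tessellation. The plane is the upper sheet of the
    hyperboloid in R^3 with the form xx' + yy' - zz'; its lines are the orthogonals
    of unit vectors, and the lines that occur here are those of the roots, the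
    images of the normals [alpha s] of the sides. The polygon is chosen tangent to a
    circle ([polygon_exists]); the circle has the base point as its centre, so that
    all the [alpha s] have the same product [sigma] with the base point, and
    compactness is the numerical condition [sigma < eta].

    By Tits' theorem ([ascent_comb]) the length of an element is governed by the
    signs of roots. Hence [v] lies in the cone type of [w] iff no root line
    separates the identity from both [w^-1] and [v] ([cone_type_separation]). A line
    far from the base point lies behind the line of a side
    ([high_root_dominates]), and only finitely many roots are low
    ([finitely_many_low_roots]), so the cone type of [w] depends only on the
    position of [w^-1] with respect to finitely many lines ([finite_type_test]).

    Let T and T' be recurrent. There are infinitely many [w] of type T', so
    infinitely many chambers [w^-1] lie in one and the same intersection of finitely
    many half-planes, all of whose chambers are inverses of elements of type T'.
    The cone type T = T(p) is itself an infinite intersection of finitely many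
    half-planes. The main point, which fails in the Euclidean plane, is that
    an unbounded intersection of finitely many half-planes contains a half-plane
    ([unbounded_contains_half_plane]). For the points of the intersection escape to
    some ideal point, which can be moved into the interior of the boundary
    at infinity unless two bounding lines share that point as an end. The latter is
    impossible, since then the region would become arbitrarily thin, whereas the
    centres of the chambers stay at distance at least arsinh [sigma] from all root
    lines. Near an interior ideal point the sides of chambers cut off half-planes
    that are arbitrarily small.

    So T contains a half-plane H, and the chambers of some half-plane U are inverses
    of elements of type T'. Finally H contains the complement of a translate h U
    ([translate_inside]). As 1 is not in U, the element h is not in h U, so it lies
    in H and therefore in T = T(p); this gives a path from T to T(p h). As p^-1 is
    not in H, it lies in h U, that is, (p h)^-1 lies in U, and T(p h) = T'.
    The vertices on a path from T to T' are recurrent since there is also a path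
    back. *)

Set Implicit Arguments.
Unset Strict Implicit.
Unset Printing Implicit Defensive.

Import Order.TTheory GRing.Theory Num.Theory.
Import numFieldNormedType.Exports.
Local Open Scope ring_scope.

(** * The hyperboloid model of the hyperbolic plane *)

Section Lorentz.
Variable R : realType.

Definition vec : Type := (R * R * R)%type.

Definition form (u v : vec) : R :=
  u.1.1 * v.1.1 + u.1.2 * v.1.2 - u.2 * v.2.

Definition addv (u v : vec) : vec := (u.1.1 + v.1.1, u.1.2 + v.1.2, u.2 + v.2).
Definition scalev (k : R) (u : vec) : vec := (k * u.1.1, k * u.1.2, k * u.2).
Definition oppv : vec -> vec := scalev (-1).

Definition refl (a x : vec) : vec := addv x (scalev (- (2 * form x a)) a).

Definition base : vec := (0, 0, 1).

Definition hyp (x : vec) : Prop := form x x = -1 /\ 0 < x.2.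

Lemma formC u v : form u v = form v u.
Proof. rewrite /form; ring. Qed.

Lemma formDr x u v : form x (addv u v) = form x u + form x v.
Proof. rewrite /form /=; ring. Qed.

Lemma formDl x u v : form (addv u v) x = form u x + form v x.
Proof. rewrite /form /=; ring. Qed.

Lemma formZr x k u : form x (scalev k u) = k * form x u.
Proof. rewrite /form /=; ring. Qed.

Lemma formZl x k u : form (scalev k u) x = k * form u x.
Proof. rewrite /form /=; ring. Qed.

Lemma formNr x u : form x (oppv u) = - form x u.
Proof. rewrite /oppv formZr; ring. Qed.

Lemma formNl x u : form (oppv u) x = - form u x.
Proof. rewrite /oppv formZl; ring. Qed.

Lemma form_reflr y a x : form y (refl a x) = form y x - 2 * form x a * form y a.
Proof. rewrite /refl formDr formZr; ring. Qed.

Lemma form_refll y a x : form (refl a x) y = form x y - 2 * form x a * form a y.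
Proof. rewrite /refl formDl formZl; ring. Qed.

Lemma form_inj u v : (forall x, form u x = form v x) -> u = v.
Proof.
case: u => [[u1 u2] u3]; case: v => [[v1 v2] v3] H.
have := H (1, 0, 0); have := H (0, 1, 0); have := H (0, 0, 1).
rewrite /form /= => H3 H2 H1; congr (_, _, _); lra.
Qed.

Lemma form_base x : form base x = - x.2.
Proof. rewrite /form /=; ring. Qed.

Lemma hyp_base : hyp base.
Proof. by split; rewrite /form /=; lra. Qed.

Lemma oppvK : involutive oppv.
Proof. by move=> u; apply: form_inj => x; rewrite !formNl opprK. Qed.

Lemma form_refl a x y : form a a = 1 -> form (refl a x) (refl a y) = form x y.
Proof.
by move=> h; rewrite form_refll !form_reflr h (formC a y); ring.
Qed.

Lemma reflK a : form a a = 1 -> involutive (refl a).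
Proof.
move=> h x; apply: form_inj => y; rewrite !form_refll h; ring.
Qed.

Lemma refl_self a : form a a = 1 -> refl a a = oppv a.
Proof.
move=> h; apply: form_inj => y; rewrite form_refll formNl h; ring.
Qed.

Definition flat_norm (u : vec) : R := Num.sqrt (u.1.1 ^+ 2 + u.1.2 ^+ 2).

Lemma flat_norm_ge0 u : 0 <= flat_norm u.
Proof. exact: sqrtr_ge0. Qed.

Lemma sqr_flat_norm u : flat_norm u ^+ 2 = u.1.1 ^+ 2 + u.1.2 ^+ 2.
Proof. by rewrite sqr_sqrtr // addr_ge0 // sqr_ge0. Qed.

Lemma flat_cauchy u v :
  `|u.1.1 * v.1.1 + u.1.2 * v.1.2| <= flat_norm u * flat_norm v.
Proof.
rewrite -[leRHS]ger0_norm; last by rewrite mulr_ge0 ?flat_norm_ge0.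
rewrite -ler_sqr ?nnegrE ?normr_ge0 // !real_normK ?num_real //.
rewrite exprMn !sqr_flat_norm.
have := sqr_ge0 (u.1.1 * v.1.2 - u.1.2 * v.1.1); nra.
Qed.

Lemma hyp_norm x : hyp x -> flat_norm x ^+ 2 = x.2 ^+ 2 - 1.
Proof. by case=> h _; rewrite sqr_flat_norm; move: h; rewrite /form; nra. Qed.

Lemma hyp_norm_lt x : hyp x -> flat_norm x < x.2.
Proof.
move=> hx; have h := hyp_norm hx; have h0 := flat_norm_ge0 x.
have h2 := hx.2; nra.
Qed.

Lemma hyp_height_ge1 x : hyp x -> 1 <= x.2.
Proof.
move=> hx; have h := hyp_norm hx; have h0 := flat_norm_ge0 x.
have h2 := hx.2; nra.
Qed.

Lemma unit_norm a : form a a = 1 -> flat_norm a ^+ 2 = 1 + a.2 ^+ 2.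
Proof. by rewrite sqr_flat_norm /form => h; nra. Qed.

(** A causal vector lies in a closed half of the light cone, so its products
    with the points of the upper hyperboloid all have the same sign. *)
Lemma causal_sign n x y : form n n <= 0 -> hyp x -> hyp y ->
  0 < form x n -> form y n < 0 -> False.
Proof.
move=> hn hx hy hxn hyn.
have h : flat_norm n <= `|n.2|.
  rewrite -ler_sqr ?nnegrE ?normr_ge0 ?flat_norm_ge0 //.
  rewrite real_normK ?num_real // sqr_flat_norm.
  by move: hn; rewrite /form; nra.
have key z : hyp z -> `|z.1.1 * n.1.1 + z.1.2 * n.1.2| <= z.2 * `|n.2|.
  move=> hz; apply: le_trans (flat_cauchy z n) _.
  by apply: ler_pM; rewrite ?flat_norm_ge0 // ltW // hyp_norm_lt.
have := key _ hx; have := key _ hy; rewrite !ler_norml.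
move: hxn hyn; rewrite /form; have := hx.2; have := hy.2.
case: (lerP 0 n.2) => h0; [rewrite ger0_norm // | rewrite ltr0_norm //] => *; nra.
Qed.

(** The sum of the two normals is causal, so [causal_sign] applies to it. The
    point [y] is needed because [form a b <= -1] also holds when the two half-planes
    cover the plane. *)
Lemma disjoint_half_planes a b x y : form a a = 1 -> form b b = 1 ->
  form a b <= -1 -> hyp y -> form y a < 0 -> form y b <= 0 ->
  hyp x -> 0 < form x a -> form x b <= 0.
Proof.
move=> ha hb hab hy hya hyb hx hxa; rewrite leNgt; apply/negP => hxb.
apply: (@causal_sign (addv a b) x y) => //.
- by rewrite !formDr !formDl (formC b a) ha hb; lra.
- by rewrite formDr; lra.
- by rewrite formDr; lra.
Qed.

(** Chebyshev polynomials of the second kind, shifted by one: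
    [cheb (cos t) n = sin (n t) / sin t]. *)
Fixpoint cheb (c : R) (n : nat) : R :=
  match n with
  | 0 => 0
  | p.+1 => match p with 0 => 1 | q.+1 => 2 * c * cheb c p - cheb c q end
  end.

Lemma chebSS c n : cheb c n.+2 = 2 * c * cheb c n.+1 - cheb c n.
Proof. by []. Qed.

Lemma cheb_cassini c n :
  cheb c n ^+ 2 + cheb c n.+1 ^+ 2 - 2 * c * cheb c n * cheb c n.+1 = 1.
Proof.
elim: n => [|n IH]; first by rewrite /=; ring.
by rewrite chebSS -[RHS]IH; ring.
Qed.

Lemma cheb_ge0 c n : 1 <= c -> 0 <= cheb c n.
Proof.
move=> hc; suff [] : 0 <= cheb c n /\ cheb c n <= cheb c n.+1 by [].
elim: n => [|n [h1 h2]]; first by split => //=; lra.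
split; [lra | rewrite chebSS; nra].
Qed.

(** The powers of a product of two reflections are read off from the Chebyshev
    polynomials; hence the braid relations once [cheb c k = 0]. *)
Lemma refl_pair_pow a b x n : form a a = 1 -> form b b = 1 ->
  let c := - form a b in
  iter n (fun y => refl a (refl b y)) x =
  addv x (addv
    (scalev (-2 * cheb c n * (form x b * cheb c n.+1 + form x a * cheb c n)) a)
    (scalev (-2 * cheb c n *
             (form x b * cheb c n
              + form x a * (2 * c * cheb c n - cheb c n.+1))) b)).
Proof.
move=> ha hb c.
elim: n => [|n IH]; first by apply: form_inj => y /=; rewrite !formDl !formZl; ring.
rewrite iterS IH; apply: form_inj => y.
have cas := cheb_cassini c n.
rewrite /refl !(formDl, formDr, formZl, formZr) ha hb (formC b a).
have -> : form a b = - c by rewrite /c opprK.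
rewrite chebSS; move: cas.
set p := cheb c n; set q := cheb c n.+1.
set X := form x a; set Y := form x b; set A := form a y; set B := form b y.
move=> cas.
apply/eqP; rewrite -subr_eq0; apply/eqP.
set lhs := LHS.
have -> : lhs = (p ^+ 2 + q ^+ 2 - 2 * c * p * q - 1) * (2 * Y * B + 2 * (X + 2 * c * Y) * A) by rewrite /lhs; ring.
by rewrite cas subrr mul0r.
Qed.

End Lorentz.

(** * Rays and limits in the hyperbolic plane *)

Section Rays.
Variable R : realType.
Implicit Types (x y a b : vec R) (p q : R).
Local Notation base := (base R).

Lemma sqr_le_norm (u v : R) : `|u| <= v -> u ^+ 2 <= v ^+ 2.
Proof.
move=> h; have v0 : 0 <= v := le_trans (normr_ge0 u) h.
by rewrite -real_normK ?num_real // ler_sqr ?nnegrE.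
Qed.

Lemma hyp_form_bounds x y : hyp x -> hyp y ->
  - (2 * x.2 * y.2) <= form x y < 0.
Proof.
move=> hx hy; have nx := hyp_norm_lt hx; have ny := hyp_norm_lt hy.
have x0 := flat_norm_ge0 x; have y0 := flat_norm_ge0 y.
have lt : flat_norm x * flat_norm y < x.2 * y.2 by apply: ltr_pM.
have := flat_cauchy x y; rewrite ler_norml => /andP [h1 h2].
by apply/andP; rewrite /form; split; lra.
Qed.

Lemma form_low_bound K y b : hyp y -> y.2 <= K ->
  `|form y b| <= K * (flat_norm b + `|b.2|).
Proof.
move=> hy hK; have ny := hyp_norm_lt hy; have b0 := flat_norm_ge0 b.
have y0 := hy.2; rewrite mulrDr; apply: le_trans (ler_normB _ _) _.
apply: lerD; last by rewrite normrM ler_wpM2r // ger0_norm // ltW.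
apply: le_trans (flat_cauchy y b) _; rewrite ler_wpM2r //.
by apply: ltW (lt_le_trans ny hK).
Qed.

(** The null vector of the ideal point in the direction [(p, q)]. *)
Definition ideal p q : vec R := (p, q, 1).

(** The geodesic ray from the base point to the ideal point in the direction
    [(p, q)], at distance [ln l]. *)
Definition ray p q (l : R) : vec R :=
  addv (scalev (l / 2) (ideal p q)) (scalev (l^-1 / 2) (ideal (- p) (- q))).

Lemma form_ray p q l b : form (ray p q l) b =
  l / 2 * form (ideal p q) b + l^-1 / 2 * form (ideal (- p) (- q)) b.
Proof. by rewrite /ray formDl !formZl. Qed.

Lemma hyp_ray p q l : p ^+ 2 + q ^+ 2 = 1 -> 0 < l -> hyp (ray p q l).
Proof.
move=> pq l0; have li : l * l^-1 = 1 by rewrite mulfV ?gt_eqF.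
have li0 : 0 < l^-1 by rewrite invr_gt0.
split; last by rewrite /ray /=; lra.
have -> : form (ray p q l) (ray p q l) =
   (l ^+ 2 + l^-1 ^+ 2) / 4 * (p ^+ 2 + q ^+ 2 - 1)
   - l * l^-1 * (p ^+ 2 + q ^+ 2 + 1) / 2 by rewrite /ray /form /=; field; rewrite gt_eqF.
by rewrite pq li; field; rewrite gt_eqF.
Qed.

(** The unit normal [a] of a line near the far point of parameter [l], divided by
    its height, tends to minus the null vector of the end of the ray. As that
    vector has positive product with [g], [form a g] tends to minus infinity, so
    that the two lines do not cross for large [l]. *)
Lemma far_half_plane p q g (K k : R) : p ^+ 2 + q ^+ 2 = 1 -> form g g = 1 ->
  0 < form (ideal p q) g -> 0 <= K -> 0 < k ->
  exists l0 : R, forall l, l0 <= l -> forall a, form a a = 1 ->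
    `|form (ray p q l) a| <= K -> k * l <= form base a ->
    forall x, hyp x -> form x a < 0 -> 0 <= form x g.
Proof.
move=> pq ug; set ka := form (ideal p q) g => ka0 K0 k0.
set bg := p * g.1.1 + q * g.1.2; set wg := - q * g.1.1 + p * g.1.2.
set G := `|bg| + `|wg|.
have G0 : 0 <= G by rewrite addr_ge0.
(* the point at parameter [mu] of the ray is inside the half-plane of [g] *)
set mu := 1 + `|bg + g.2| / ka.
have mu1 : 1 <= mu by rewrite /mu lerDl divr_ge0 // ltW.
set c := 2 * K + 1.
exists (1 + c + 2 * c * G / ka + (4 * G + 2) / ka / k + mu ^+ 2 / k) => l hl a ua.
have t1 : 0 <= 2 * c * G / ka.
  by rewrite divr_ge0 ?(ltW ka0) // !mulr_ge0 // /c addr_ge0 // mulr_ge0.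
have t2 : 0 <= (4 * G + 2) / ka / k by rewrite !divr_ge0 ?ltW //; lra.
have t3 : 0 <= mu ^+ 2 / k by rewrite divr_ge0 ?sqr_ge0 ?ltW.
have c1 : 1 <= c by rewrite /c; lra.
have l1 : 1 + c <= l by lra.
have l2 : 2 * c * G <= ka * l.
  by rewrite -ler_pdivrMl // mulrC; lra.
have l3 : 4 * G + 2 <= ka * (k * l).
  by rewrite -ler_pdivrMl // -ler_pdivrMl // mulrC (mulrC ka^-1); lra.
have l4 : mu ^+ 2 <= k * l by rewrite -ler_pdivrMl // mulrC; lra.
clear hl t1 t2 t3.
rewrite form_base form_ray; set A := - a.2.
set Q := p * a.1.1 + q * a.1.2; set V := - q * a.1.1 + p * a.1.2.
(* [ta] and [V] are small compared with [A]: the foot of the line turns towards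
   the end of the ray *)
set ta := Q + A.
have -> : form (ideal p q) a = ta by rewrite /ta /Q /A /form /=; ring.
have -> : form (ideal (- p) (- q)) a = 2 * A - ta
  by rewrite /ta /Q /A /form /=; ring.
move=> near hA x hx xa.
have A1 : mu ^+ 2 <= A by lra.
have A1' : 1 <= A by nra.
have QV : V ^+ 2 = 1 + 2 * A * ta - ta ^+ 2.
  have : (p ^+ 2 + q ^+ 2) * (a.1.1 ^+ 2 + a.1.2 ^+ 2) = 1 + A ^+ 2.
    by rewrite pq; move: ua; rewrite /form /A; nra.
  by rewrite /V /ta /Q => h; nra.
have ta1 : -1 <= ta by have := sqr_ge0 V; rewrite QV; nra.
have ta2 : ta - 2 * A <= 1 by have := sqr_ge0 V; rewrite QV; nra.
have ta3 : ta * l <= c.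
  have li : l * l^-1 = 1 by rewrite mulfV // gt_eqF //; lra.
  have li0 : 0 < l^-1 by rewrite invr_gt0; lra.
  have li1 : l^-1 <= 1 by rewrite invf_le1; lra.
  move: near; rewrite ler_norml => /andP [_ near].
  have : l^-1 * (ta - 2 * A) <= 1 by nra.
  by rewrite /c; nra.
have ta4 : ta <= 1 by nra.
have Vb : `|V| * l <= l + A * c.
  have [tn|tp] := leP ta 0.
    have : `|V| <= 1 by rewrite -ler_sqr ?nnegrE // real_normK ?num_real // QV; nra.
    by nra.
  have : `|V| <= 1 + A * ta.
    rewrite -ler_sqr ?nnegrE //; last nra.
    by rewrite real_normK ?num_real // QV; nra.
  by nra.
have eg : form a g = - (A * ka) + ta * bg + V * wg.
  have -> : form a g = (p ^+ 2 + q ^+ 2) * (a.1.1 * g.1.1 + a.1.2 * g.1.2) + A * g.2.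
    by rewrite pq /form /A; ring.
  by rewrite /ka /form /ta /Q /V /bg /wg /=; ring.
have bound : form a g <= -1.
  have h1 : ta * bg <= G.
    apply: le_trans (ler_norm _) _; rewrite normrM.
    have : `|ta| <= 1 by rewrite ler_norml; lra.
    have := normr_ge0 bg; have := normr_ge0 wg; rewrite /G; nra.
  have h2 : V * wg <= `|V| * G.
    apply: le_trans (ler_norm _) _; rewrite normrM.
    have := normr_ge0 V; have := normr_ge0 bg; rewrite /G; nra.
  have l0 : 0 < l by lra.
  have V0 := normr_ge0 V.
  rewrite -(ler_pM2r l0).
  have h3 : `|V| * G * l <= (l + A * c) * G by nra.
  have h4 : A * (c * G) * 2 <= A * (ka * l) by rewrite -mulrA ler_wpM2l //; lra.
  have h5 : 4 * G + 2 <= ka * A by nra.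
  rewrite eg; nra.
have mu0 : 0 < mu by lra.
have mui : mu * mu^-1 = 1 by rewrite mulfV // gt_eqF.
have mui0 : 0 < mu^-1 by rewrite invr_gt0.
have muk : `|bg + g.2| < mu * ka.
  by rewrite /mu mulrDl mulfVK ?gt_eqF // mul1r ltrDr.
pose y := ray p q mu.
rewrite -oppr_le0 -formNr.
apply: (@disjoint_half_planes _ (oppv a) (oppv g) x y).
- by rewrite formNl formNr opprK.
- by rewrite formNl formNr opprK.
- by rewrite formNl formNr opprK.
- exact: hyp_ray.
- rewrite formNr /y form_ray oppr_lt0.
  have -> : form (ideal p q) a = ta by rewrite /ta /Q /A /form /=; ring.
  have -> : form (ideal (- p) (- q)) a = 2 * A - ta
    by rewrite /ta /Q /A /form /=; ring.
  rewrite -(ltr_pM2l mu0); nra.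
- rewrite formNr /y form_ray oppr_le0 -/ka.
  have -> : form (ideal (- p) (- q)) g = - (bg + g.2)
    by rewrite /bg /form /=; ring.
  have := ler_norm (bg + g.2); nra.
- exact: hx.
- by rewrite formNr oppr_gt0.
Qed.

Lemma cluster_point (A : nat -> R -> Prop) :
  (forall n, exists t, A n t) ->
  (forall n k t, (n <= k)%N -> A k t -> A n t) ->
  (forall n t, A n t -> `|t| <= 1) ->
  exists t0, forall n e, 0 < e -> exists2 t, A n t & `|t - t0| < e.
Proof.
move=> A0 Amon A1.
pose E := [set t : R | forall n, exists2 u, A n u & t <= u]%classic.
have EN : E (-1).
  by move=> n; have [u Au] := A0 n; exists u => //; have := A1 _ _ Au; rewrite ler_norml => /andP [].
have ubE : ubound E 1.
  move=> t /(_ 0%N) [u Au tu]; apply: le_trans tu _.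
  by have := A1 _ _ Au; rewrite ler_norml => /andP [].
have hE : has_sup E by split; [exists (-1) | exists 1].
exists (sup E) => n e e0.
have [t Et lt] := sup_adherent e0 hE.
have : ~ E (sup E + e / 2).
  by move=> /(ub_le_sup (proj2 hE)); rewrite gerDl; lra.
move=> /existsNP [n0 h0].
have [u Au tu] := Et (maxn n n0).
exists u; first by apply: Amon Au; rewrite leq_maxl.
have : ~ sup E + e / 2 <= u.
  by move=> h; apply: h0; exists u => //; apply: Amon Au; rewrite leq_maxr.
by move/negP; rewrite -ltNge ltr_distl => h; apply/andP; split; lra.
Qed.

(** Some points of [D] tend to the ideal point in the direction [(p, q)]; the errors
    are measured against the height to avoid quotients. *)
Definition escapes (D : vec R -> Prop) p q := forall K e : R, 0 < e ->
  exists x, [/\ D x, K <= x.2, `|x.1.1 - p * x.2| <= e * x.2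
              & `|x.1.2 - q * x.2| <= e * x.2].

Lemma escape_exists (D : vec R -> Prop) : (forall x, D x -> hyp x) ->
  (forall n : nat, exists2 x, D x & n%:R <= x.2) -> exists p q, escapes D p q.
Proof.
move=> Dh Dn.
have comp x : D x -> `|x.1.1| <= x.2 /\ `|x.1.2| <= x.2.
  move=> /Dh hx; have x0 := hx.2; have [+ _] := hx; rewrite /form => hx'.
  by split; rewrite -ler_sqr ?nnegrE ?(ltW x0) // real_normK ?num_real //; nra.
pose A n t := exists x, [/\ D x, n%:R <= x.2 & x.1.1 = t * x.2].
have [|||p hp] := @cluster_point A.
- move=> n; have [x Dx nx] := Dn n; exists (x.1.1 / x.2), x; split=> //.
  by rewrite mulfVK // gt_eqF // (Dh x Dx).2.
- move=> n k t nk [x [Dx kx e]]; exists x; split=> //.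
  by apply: le_trans kx; rewrite ler_nat.
- move=> n t [x [Dx _ e]]; have x0 := (Dh x Dx).2; have [h _] := comp x Dx.
  by move: h; rewrite e normrM (gtr0_norm x0) ger_pMl.
pose B n t := exists x, [/\ D x, n%:R <= x.2, `|x.1.1 - p * x.2| <= n.+1%:R^-1 * x.2
   & x.1.2 = t * x.2].
have [|||q hq] := @cluster_point B.
- move=> n; have [|t [x [Dx nx e]] ht] := hp n n.+1%:R^-1; first by rewrite invr_gt0.
  have x0 := (Dh x Dx).2.
  exists (x.1.2 / x.2), x; split=> //; last by rewrite mulfVK // gt_eqF.
  by rewrite e -mulrBl normrM (gtr0_norm x0) ler_wpM2r // ltW.
- move=> n k t nk [x [Dx kx h e]]; have x0 := (Dh x Dx).2; exists x; split=> //.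
    by apply: le_trans kx; rewrite ler_nat.
  by apply: le_trans h _; rewrite ler_wpM2r ?(ltW x0) // lef_pV2 ?posrE // ler_nat.
- move=> n t [x [Dx _ _ e]]; have x0 := (Dh x Dx).2; have [_ h] := comp x Dx.
  by move: h; rewrite e normrM (gtr0_norm x0) ger_pMl.
exists p, q => K e e0.
pose n := Num.bound (`|K| + e^-1).
have nb : `|K| + e^-1 < n%:R.
  by apply: archi_boundP; rewrite addr_ge0 // invr_ge0 ltW.
have ei : 0 < e^-1 by rewrite invr_gt0.
have [t [x [Dx nx h1 h2]] ht] := hq n e e0.
have x0 := (Dh x Dx).2; exists x; split=> //.
- by have := ler_norm K; lra.
- apply: le_trans h1 _; rewrite ler_wpM2r ?(ltW x0) // invf_ple ?posrE //.
  by rewrite -natr1; have := normr_ge0 K; lra.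
- by rewrite h2 -mulrBl normrM (gtr0_norm x0) ler_wpM2r // ltW.
Qed.

Lemma escape_unit D p q : (forall x, D x -> hyp x) -> escapes D p q ->
  p ^+ 2 + q ^+ 2 = 1.
Proof.
move=> Dh esc; apply/eqP; rewrite -subr_eq0 -normr_eq0 eq_le normr_ge0 andbT.
rewrite leNgt; apply/negP; set d := `|_| => d0.
set k := `|p| + `|q|; have k0 : 0 <= k by rewrite addr_ge0.
pose e := d / (4 * (k + 1) + d).
have den : 0 < 4 * (k + 1) + d by lra.
have e0 : 0 < e by rewrite divr_gt0.
have e1 : e * (4 * (k + 1) + d) = d by rewrite mulfVK // gt_eqF.
have e2 : e <= 1 by nra.
have [x [Dx Kx h1 h2]] := esc (4 / d + 1) e e0.
have [+ z0] := Dh x Dx; rewrite /form; set z := x.2 in Kx h1 h2 z0 *.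
have -> : x.1.1 = p * z + (x.1.1 - p * z) by ring.
have -> : x.1.2 = q * z + (x.1.2 - q * z) by ring.
move: h1 h2; set r1 := x.1.1 - _; set r2 := x.1.2 - _ => h1 h2 eq.
have zd : 4 < d * z.
  have d4 : d * (4 / d) = 4 by rewrite mulrC mulfVK // gt_eqF.
  by nra.
have d40 : 0 <= 4 / d by rewrite divr_ge0 // ltW.
have z1 : 1 <= z by lra.
have sq1 := sqr_le_norm h1.
have sq2 := sqr_le_norm h2.
have c1 : `|p * r1| <= `|p| * (e * z) by rewrite normrM ler_wpM2l.
have c2 : `|q * r2| <= `|q| * (e * z) by rewrite normrM ler_wpM2l.
have main : d * z ^+ 2 <= 1 + 2 * k * e * z ^+ 2 + 2 * e ^+ 2 * z ^+ 2.
  rewrite -(ger0_norm (sqr_ge0 z)) -normrM.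
  have -> : (p ^+ 2 + q ^+ 2 - 1) * z ^+ 2 =
    -1 - 2 * z * (p * r1) - 2 * z * (q * r2) - r1 ^+ 2 - r2 ^+ 2 by nra.
  move: c1 c2; rewrite (ger0_norm (sqr_ge0 z)) !ler_norml /k => /andP [a1 a2] /andP [b1 b2].
  by apply/andP; split; nra.
have : d * z ^+ 2 <= 1 + (d / 2) * z ^+ 2.
  apply: le_trans main _; rewrite -addrA lerD2l -mulrDl ler_wpM2r ?sqr_ge0 //.
  nra.
nra.
Qed.

Lemma escape_nonneg D p q g : (forall x, D x -> hyp x) -> escapes D p q ->
  (forall x, D x -> 0 < form x g) -> 0 <= form (ideal p q) g.
Proof.
move=> Dh esc pos; rewrite leNgt; apply/negP => neg.
set k := form _ _ in neg.
set G := `|g.1.1| + `|g.1.2| + 1.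
have G1 : 1 <= G by rewrite lerDr addr_ge0.
have [|x [Dx _ h1 h2]] := esc 0 (- k / G); first by apply: divr_gt0; lra.
have z0 := (Dh x Dx).2; have := pos x Dx; apply/negP; rewrite -leNgt.
have -> : form x g = x.2 * k + (x.1.1 - p * x.2) * g.1.1 + (x.1.2 - q * x.2) * g.1.2.
  by rewrite /k /form /=; ring.
set e := - k / G in h1 h2.
have eG : e * G = - k by rewrite mulfVK // gt_eqF; lra.
have a1 : (x.1.1 - p * x.2) * g.1.1 <= e * x.2 * `|g.1.1|.
  by apply: le_trans (ler_norm _) _; rewrite normrM ler_wpM2r.
have a2 : (x.1.2 - q * x.2) * g.1.2 <= e * x.2 * `|g.1.2|.
  by apply: le_trans (ler_norm _) _; rewrite normrM ler_wpM2r.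
have : x.2 * k = - (e * x.2 * G) by rewrite mulrAC eG; ring.
have : 0 <= e * x.2 by apply: mulr_ge0; [apply: divr_ge0; lra | exact: ltW].
by rewrite /G => f0 eq; lra.
Qed.

Lemma ideal_frame p q g : p ^+ 2 + q ^+ 2 = 1 ->
  g.1.1 = p * (form (ideal p q) g + g.2) - q * form (- q, p, 0) g /\
  g.1.2 = q * (form (ideal p q) g + g.2) + p * form (- q, p, 0) g.
Proof.
by move=> pq; split; rewrite -[LHS]mul1r -pq /form /=; ring.
Qed.

(** The normals of two lines with a common end add up to a multiple of its null
    vector, whose product with a point tends to [0] along the strip between the
    lines, while it stays at least [2 * s] in [D]. *)
Lemma asymptotic_strip D p q g1 g2 (s : R) : (forall x, D x -> hyp x) ->
  escapes D p q -> form (ideal p q) g1 = 0 -> form (ideal p q) g2 = 0 ->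
  form (- q, p, 0) g1 = 1 -> form (- q, p, 0) g2 = -1 -> 0 < s ->
  (forall x, D x -> s <= form x g1 /\ s <= form x g2) -> False.
Proof.
move=> Dh esc z1 z2 m1 m2 s0 pos.
have pq := escape_unit Dh esc.
set h1 := g1.2; set h2 := g2.2.
have e1 : g1.1.1 = h1 * p - q /\ g1.1.2 = h1 * q + p.
  by have [-> ->] := ideal_frame g1 pq; rewrite z1 m1 -/h1; split; ring.
have e2 : g2.1.1 = h2 * p + q /\ g2.1.2 = h2 * q - p.
  by have [-> ->] := ideal_frame g2 pq; rewrite z2 m2 -/h2; split; ring.
set t := `|h1| + `|h2|.
have t0 : 0 <= t by rewrite addr_ge0.
set k := `|p| + `|q|; have k0 : 0 <= k by rewrite addr_ge0.
set c := (1 + t ^+ 2) * (k + 1).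
have c0 : 0 < c by rewrite mulr_gt0 //; nra.
have ci : 0 < c^-1 by rewrite invr_gt0.
have [x [Dx Kx r1 r2]] := esc (t / s + 1) c^-1 ci.
have [hx z0] := Dh x Dx; have [f1 f2] := pos x Dx.
set z := x.2 in Kx r1 r2 z0.
set Q := z - (p * x.1.1 + q * x.1.2); set M := - q * x.1.1 + p * x.1.2.
have fm1 : form x g1 = M - h1 * Q.
  by rewrite /form e1.1 e1.2 -/h1 /M /Q /z; ring.
have fm2 : form x g2 = - M - h2 * Q.
  by rewrite /form e2.1 e2.2 -/h2 /M /Q /z; ring.
have prod : Q * (2 * z - Q) = 1 + M ^+ 2.
  have : x.1.1 ^+ 2 + x.1.2 ^+ 2 = (p ^+ 2 + q ^+ 2) * (x.1.1 ^+ 2 + x.1.2 ^+ 2).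
    by rewrite pq mul1r.
  by move: hx; rewrite /form -/z /Q /M => h h'; nra.
have Qup : Q <= k * (c^-1 * z).
  have -> : Q = - (p * (x.1.1 - p * z)) - q * (x.1.2 - q * z).
    have : z = (p ^+ 2 + q ^+ 2) * z by rewrite pq mul1r.
    by rewrite /Q => h; nra.
  have a1 : `|p * (x.1.1 - p * z)| <= `|p| * (c^-1 * z) by rewrite normrM ler_wpM2l.
  have a2 : `|q * (x.1.2 - q * z)| <= `|q| * (c^-1 * z) by rewrite normrM ler_wpM2l.
  move: a1 a2; rewrite !ler_norml /k => /andP [u1 u2] /andP [v1 v2]; lra.
have Q0 : 0 < Q.
  rewrite ltNge; apply/negP => Qn.
  have : Q * (2 * z - Q) <= 0 by nra.
  by rewrite prod; have := sqr_ge0 M; lra.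
have n1 : - h1 <= `|h1| by rewrite -normrN ler_norm.
have n2 : - h2 <= `|h2| by rewrite -normrN ler_norm.
have tQ : 2 * s <= t * Q by rewrite /t; nra.
have M2 : M ^+ 2 <= (t * Q) ^+ 2.
  have Q1 : 0 <= `|h1| * Q by rewrite mulr_ge0 // ltW.
  have Q2 : 0 <= `|h2| * Q by rewrite mulr_ge0 // ltW.
  by apply: sqr_le_norm; rewrite ler_norml /t; apply/andP; split; nra.
have cc : c * c^-1 = 1 by rewrite mulfV // gt_eqF.
have zQ : z * Q <= 1.
  have : (1 + t ^+ 2) * Q <= z.
    have : (1 + t ^+ 2) * (k * c^-1) <= 1 by rewrite /c in cc ci *; nra.
    have : (1 + t ^+ 2) * Q <= (1 + t ^+ 2) * (k * (c^-1 * z)).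
      by rewrite ler_wpM2l // addr_ge0 // sqr_ge0.
    move=> a b; apply: le_trans a _; rewrite !mulrA in b *; nra.
  by move: M2 prod; rewrite exprMn => *; nra.
have sz : t + s <= s * z.
  have <- : s * (t / s + 1) = t + s by rewrite mulrDr mulr1 mulrC mulfVK // gt_eqF.
  by rewrite ler_wpM2l // ltW.
nra.
Qed.

Lemma near0_all (E : seq (vec R)) (Q : vec R -> R -> Prop) :
  {in E, forall g, exists2 e0 : R, 0 < e0 & forall e, 0 < e -> e < e0 -> Q g e} ->
  exists2 e : R, 0 < e & {in E, forall g, Q g e}.
Proof.
move=> H.
suff [e0 e00 h] : exists2 e0 : R, 0 < e0 &
    forall e, 0 < e -> e < e0 -> {in E, forall g, Q g e}.
  by exists (e0 / 2); [lra | apply: h; lra].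
elim: E H => [|g E IH] H; first by exists 1.
have [|e1 e10 h1] := IH; first by move=> b bE; apply: H; rewrite inE bE orbT.
have [|e2 e20 h2] := H g; first by rewrite inE eqxx.
exists (Num.min e1 e2); first by rewrite lt_min e10.
move=> e e0; rewrite lt_min => /andP [l1 l2] b; rewrite inE => /orP [/eqP ->|].
  exact: h2.
exact: h1.
Qed.

(** If the ideal point to which [D] escapes is an end of some of the lines, these
    all touch it from the same side by [asymptotic_strip], so that a small rotation
    moves it inside all the half-planes. *)
Lemma interior_direction (D : vec R -> Prop) (E : seq (vec R)) (s : R) :
  (forall x, D x -> hyp x) -> (forall n : nat, exists2 x, D x & n%:R <= x.2) ->
  0 < s -> {in E, forall g, form g g = 1} ->
  (forall x, D x -> {in E, forall g, s <= form x g}) ->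
  exists p q, p ^+ 2 + q ^+ 2 = 1 /\ {in E, forall g, 0 < form (ideal p q) g}.
Proof.
move=> Dh Dn s0 uE pos.
have [p [q esc]] := escape_exists Dh Dn.
have pq := escape_unit Dh esc.
have nonneg g : g \in E -> 0 <= form (ideal p q) g.
  by move=> gE; apply: (escape_nonneg Dh esc) => x Dx; apply: lt_le_trans s0 (pos x Dx g gE).
pose m : vec R := (- q, p, 0).
have tangent g : g \in E -> form (ideal p q) g = 0 -> form m g = 1 \/ form m g = -1.
  move=> gE z; have : form m g ^+ 2 = 1.
    have : (p ^+ 2 + q ^+ 2) * (g.1.1 ^+ 2 + g.1.2 ^+ 2) = 1 + g.2 ^+ 2.
      by rewrite pq; have := uE g gE; rewrite /form; nra.
    by move: z; rewrite /form /= => z h; nra.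
  by move/eqP; rewrite sqrf_eq1 => /orP [] /eqP; [left | right].
(* [si] is the side on which lines touch the ideal point *)
have [si [si1 sib]] : exists si : R, si ^+ 2 = 1 /\
    {in E, forall g, form (ideal p q) g = 0 -> si * form m g = 1}.
  case: (pselect (exists2 g, g \in E & form (ideal p q) g = 0 /\ form m g = 1)).
    case=> g1 g1E [z1 m1]; exists 1; split=> [|g gE z]; first by rewrite expr1n.
    rewrite mul1r; case: (tangent g gE z) => // m2.
    exfalso; apply: (asymptotic_strip Dh esc z1 z m1 m2 s0) => x Dx.
    by split; apply: pos.
  move=> no; exists (-1); split=> [|g gE z]; first by rewrite sqrrN expr1n.
  case: (tangent g gE z) => mg; last by rewrite mg; ring.
  by case: no; exists g.
(* the rotation by [2 * atan e] towards that side *)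
pose rp e := ((1 - e ^+ 2) * p - 2 * e * si * q) / (1 + e ^+ 2).
pose rq e := ((1 - e ^+ 2) * q + 2 * e * si * p) / (1 + e ^+ 2).
have [|e e0 he] := @near0_all E (fun g e => 0 < form (ideal (rp e) (rq e)) g).
  move=> g gE.
  set a := p * g.1.1 + q * g.1.2; set k := form (ideal p q) g.
  have fe e : form (ideal (rp e) (rq e)) g =
      (k + 2 * e * (si * form m g) - e ^+ 2 * (a + g.2)) / (1 + e ^+ 2).
    rewrite /k /rp /rq /form /= /a; field.
    by rewrite gt_eqF // ltr_wpDr // sqr_ge0.
  set b := si * form m g in fe.
  set r := `|a + g.2|; set d := `|b|.
  have ra : a + g.2 <= r := ler_norm _.
  have rd : - b <= d by rewrite -[d]normrN ler_norm.
  have r0 : 0 <= r := normr_ge0 _.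
  have d0 : 0 <= d := normr_ge0 _.
  clearbody r d.
  have [kz|kn] := eqVneq k 0.
    have b1 : b = 1 := sib g gE kz.
    exists (1 + r)^-1 => [|e e0 elt]; first by rewrite invr_gt0; lra.
    rewrite fe kz b1; apply: divr_gt0; last by rewrite ltr_wpDr // sqr_ge0.
    have : e * (1 + r) < 1 by rewrite -ltr_pdivlMr ?div1r //; lra.
    by nra.
  have kp : 0 < k by rewrite lt_def kn nonneg.
  exists (Num.min 1 (k / (1 + r + 2 * d))) => [|e e0].
    by rewrite lt_min ltr01; apply: divr_gt0 => //; lra.
  rewrite lt_min => /andP [e1 elt].
  have : e * (1 + r + 2 * d) < k by rewrite -ltr_pdivlMr //; lra.
  move=> h; rewrite fe; apply: divr_gt0; last by rewrite ltr_wpDr // sqr_ge0.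
  have h1 : - (e * b) <= e * d by rewrite -mulrN ler_wpM2l // ltW.
  have h2 : e ^+ 2 * (a + g.2) <= e ^+ 2 * r by rewrite ler_wpM2l // sqr_ge0.
  have h3 : e ^+ 2 * r <= e * r by rewrite ler_wpM2r // expr2 ger_pMl // ltW.
  lra.
exists (rp e), (rq e); split=> //.
have den : 1 + e ^+ 2 != 0 by rewrite gt_eqF // ltr_wpDr // sqr_ge0.
have -> : rp e ^+ 2 + rq e ^+ 2 =
    ((1 - e ^+ 2) ^+ 2 + 4 * e ^+ 2 * si ^+ 2) * (p ^+ 2 + q ^+ 2) / (1 + e ^+ 2) ^+ 2.
  by rewrite /rp /rq; field; exact: den.
by rewrite pq si1; field; exact: den.
Qed.

End Rays.

(** The inward unit normals [alpha s] of a polygon tangent to a circle centred at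
    the base point. A vertex of angle [pi / k] enters only through the values at
    [- form (alpha s) (alpha t) = cos (pi / k)] of the Chebyshev polynomials. The
    conditions on [eta] express compactness: in every direction the ray from the
    base point meets some side at bounded distance. *)
Record lorentz_polygon (R : realType) (S : finType) (m : coxeter_matrix S)
    (alpha : S -> vec R) (sigma eta : R) : Prop := LorentzPolygon {
  lp_unit : forall s, form (alpha s) (alpha s) = 1;
  lp_height : forall s, form (base R) (alpha s) = sigma;
  lp_sigma : 0 < sigma;
  lp_eta : sigma < eta;
  lp_finite : forall (s t : S) (k : nat), s != t -> m s t = Some k ->
    cheb (- form (alpha s) (alpha t)) k = 0 /\
    forall j, (j <= k)%N -> 0 <= cheb (- form (alpha s) (alpha t)) j;
  lp_infinite : forall s t : S, s != t -> m s t = None ->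
    form (alpha s) (alpha t) <= -1;
  lp_spread : forall x : vec R, exists s,
    eta * flat_norm x <= (alpha s).1.1 * x.1.1 + (alpha s).1.2 * x.1.2
}.

(** * Word length in a Coxeter system *)

Section Fuchsian.
Variables (S : finType) (m : coxeter_matrix S) (W : groupType).
Variable c : coxeter_system m W.
Local Notation wp := (word_prod c).
Local Notation len := (cox_length c).
Implicit Types (u v w g h : W) (s t : S) (a b : seq S).

Local Open Scope nat_scope.
Local Open Scope group_scope.

Lemma wp_nil : wp [::] = 1.
Proof. by rewrite /word_prod big_nil. Qed.

Lemma wp_cons s a : wp (s :: a) = c s * wp a.
Proof. by rewrite /word_prod big_cons. Qed.

Lemma wp_cat a b : wp (a ++ b) = wp a * wp b.
Proof. by rewrite /word_prod big_cat. Qed.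

Lemma wp1 s : wp [:: s] = c s.
Proof. by rewrite wp_cons wp_nil mulg1. Qed.

Lemma gen_sq s : c s * c s = 1.
Proof.
have /(cox_presents c) : coxeter_equiv m [:: s; s] [::].
  by apply: coxeter_equiv_relator; constructor.
by rewrite wp_nil wp_cons wp1.
Qed.

Lemma genK s w : w * c s * c s = w.
Proof. by rewrite -mulgA gen_sq mulg1. Qed.

Lemma genV s : (c s)^-1 = c s.
Proof. by apply: (mulgI (c s)); rewrite mulgV gen_sq. Qed.

Lemma wp_rev a : wp (rev a) = (wp a)^-1.
Proof.
elim: a => [|s a IH]; first by rewrite wp_nil invg1.
by rewrite rev_cons -cats1 wp_cat IH wp1 wp_cons invgM genV.
Qed.

Lemma lenP w : exists a, wp a = w /\ size a = len w.
Proof.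
rewrite /cox_length; case: ex_minnP => k /existsP [a /eqP <-] _.
by exists a; rewrite size_tuple.
Qed.

Lemma len_le a : (len (wp a) <= size a)%N.
Proof.
rewrite /cox_length; case: ex_minnP => k _; apply.
by apply/existsP; exists (in_tuple a).
Qed.

Lemma lenM u v : (len (u * v) <= len u + len v)%N.
Proof.
have [a [<- <-]] := lenP u; have [b [<- <-]] := lenP v.
by rewrite -wp_cat -size_cat len_le.
Qed.

Lemma len1 : len 1 = 0%N.
Proof. by apply/eqP; rewrite -leqn0 -wp_nil len_le. Qed.

Lemma len_eq0 w : len w = 0%N -> w = 1.
Proof.
by have [a [<- <-]] := lenP w => /size0nil ->; rewrite wp_nil.
Qed.

Lemma lenV w : len w^-1 = len w.
Proof.
have le v : (len v^-1 <= len v)%N.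
  by have [a [<- <-]] := lenP v; rewrite -wp_rev -size_rev len_le.
by apply/eqP; rewrite eqn_leq le -{1}(invgK w) le.
Qed.

Lemma len_gen s : (len (c s) <= 1)%N.
Proof. by rewrite -wp1 len_le. Qed.

(** The relators have even length, so the parity of a word only depends on the
    element that it represents. *)
Lemma equiv_parity a b : coxeter_equiv m a b -> odd (size a) = odd (size b).
Proof.
elim=> {a b} [r|//|a b _ ->//|a b d _ -> _ ->//|a a' b b' _ ih _ ih'].
  case=> [//|s t k _ _] /=; elim: k => //= k IH.
  by rewrite negbK.
by rewrite !size_cat !oddD ih ih'.
Qed.

Lemma len_parity a : odd (len (wp a)) = odd (size a).
Proof.
have [b [eb <-]] := lenP (wp a).
exact/equiv_parity/(cox_presents c).
Qed.

Lemma len_gen_neq w s : len (w * c s) <> len w.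
Proof.
have [a [<- _]] := lenP w.
move=> /(congr1 odd); rewrite -wp1 -wp_cat !len_parity size_cat addn1 /=.
by case: odd.
Qed.

Lemma len_mul_gen w s :
  len (w * c s) = (len w).+1 \/ (len (w * c s)).+1 = len w.
Proof.
have h1 := lenM w (c s); have h2 := lenM (w * c s) (c s).
have h3 := len_gen s; have h4 := @len_gen_neq w s.
move: h2; rewrite genK; lia.
Qed.

Lemma descent_exists w : w <> 1 -> exists t, (len (w * c t)).+1 = len w.
Proof.
have [a [<- sa]] := lenP w; case/lastP: a sa => [|a t] sa; first by rewrite wp_nil.
move=> _; exists t; have := @len_mul_gen (wp (rcons a t)) t.
have : (len (wp (rcons a t) * c t) <= size a)%N.
  by rewrite -cats1 wp_cat wp1 genK len_le.
move: sa; rewrite size_rcons; lia.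
Qed.

Fixpoint alt (s t : S) (n : nat) : seq S :=
  if n is p.+1 then s :: alt t s p else [::].

Lemma size_alt s t n : size (alt s t n) = n.
Proof. by elim: n s t => //= n IH s t; rewrite IH. Qed.

Lemma alt_double s t k : alt s t (k.*2) = flatten (nseq k [:: s; t]).
Proof. by elim: k => //= k ->. Qed.

Lemma alt_split s t n p : exists s' t', alt s t (n + p) = alt s t n ++ alt s' t' p.
Proof.
elim: n s t => [|n IH] s t; first by exists s, t.
by have [s' [t' /= ->]] := IH t s; exists s', t'.
Qed.

(** The rest of the braid relator is a shorter word for the inverse. *)
Lemma alt_braid s t k : s != t -> m s t = Some k ->
  (0 < k)%N -> (len (wp (alt s t k.+1)) <= k.-1)%N.
Proof.
move=> st mst k0.
have [s' [t' e]] := alt_split s t k.+1 k.-1.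
have : wp (alt s t (k.+1 + k.-1)) = 1.
  have -> : (k.+1 + k.-1)%N = (k.*2)%N by lia.
  rewrite alt_double -wp_nil; apply/(cox_presents c).
  exact/coxeter_equiv_relator/relator_braid.
rewrite e wp_cat => h.
have -> : wp (alt s t k.+1) = (wp (alt s' t' k.-1))^-1.
  by apply: (mulIg (wp (alt s' t' k.-1))); rewrite h mulVg.
by rewrite lenV -{2}(size_alt s' t' k.-1) len_le.
Qed.

(** If [w] ended with a braid word for [t] and [s], the other braid word would show
    that [s] is a descent of [w]. *)
Lemma braid_descent_bound w s t k j : s != t -> m s t = Some k ->
  len (w * c s) = (len w).+1 ->
  (len w = len (w * wp (alt t s j)) + j -> j < k)%N.
Proof.
move=> st E ws lw; rewrite ltnNge; apply/negP => kj.
have k2 := cox_m_ge2 st E.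
have [s' [t' e]] := alt_split t s k (j - k).
move: lw; rewrite -{1}(subnKC kj) e wp_cat mulgA.
set v := w * wp (alt t s k); set z := wp (alt s' t' _) => lw.
have h1 : (len v <= len (v * z) + (j - k))%N.
  rewrite -{1}(mulgK z v); apply: leq_trans (lenM _ _) _.
  by rewrite lenV leq_add2l -[leqRHS](size_alt s' t' (j - k)) len_le.
have h2 : (len (w * c s) <= len v + k.-1)%N.
  have -> : w * c s = v * (wp (alt s t k.+1))^-1.
    by rewrite /= wp_cons invgM genV mulgA mulgK.
  apply: leq_trans (lenM _ _) _.
  by rewrite lenV leq_add2l alt_braid // ltnW.
clearbody v z; move: lw h1 h2 kj k2; rewrite ws; move: (len w) (len (v * z)) (len v); lia.
Qed.

Lemma alt_rcons s t n : alt s t n.+1 = rcons (alt s t n) (if odd n then t else s).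
Proof.
elim: n s t => [//|n IH] s t.
rewrite [LHS]/= -/(alt t s n.+1) IH /=.
by case: odd.
Qed.

Local Close Scope group_scope.
Local Open Scope ring_scope.

(** * The geometric representation *)

Variable R : realType.
Variables (alpha : S -> vec R) (sigma eta : R).
Hypothesis P : lorentz_polygon m alpha sigma eta.
Local Notation base := (base R).
Implicit Types (x y be : vec R).

Let unitA s : form (alpha s) (alpha s) = 1 := lp_unit P s.

Lemma alpha_obtuse s t : s != t -> form (alpha s) (alpha t) <= 0.
Proof.
move=> st; case E : (m s t) => [k|]; last first.
  by have := lp_infinite P st E; lra.
have [_ /(_ 2%N (cox_m_ge2 st E))] := lp_finite P st E.
by rewrite /=; lra.
Qed.

Definition wact a x := foldr (fun s => refl (alpha s)) x a.

Lemma wact_cat a b x : wact (a ++ b) x = wact a (wact b x).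
Proof. by rewrite /wact foldr_cat. Qed.

Lemma wact_equiv a b : coxeter_equiv m a b -> wact a =1 wact b.
Proof.
elim=> {a b} [r|//|a b _ ih x|a b d _ ih _ ih' x|a a' b b' _ ih _ ih' x] //.
- case=> [s x|s t k st E x] /=; first exact: reflK.
  have -> : wact (flatten (nseq k [:: s; t])) x =
      iter k (fun y => refl (alpha s) (refl (alpha t) y)) x.
    by elim: k {E} => //= k ->.
  rewrite refl_pair_pow //; have [-> _] := lp_finite P st E.
  by apply: form_inj => y; rewrite !formDl !formZl; ring.
- by rewrite ih ih'.
- by rewrite !wact_cat ih ih'.
Qed.

Lemma ex_word w : exists a, wp a == w.
Proof. by have [a <-] := cox_generates c w; exists a. Qed.

Definition act w := wact (xchoose (ex_word w)).

Lemma act_wp a : act (wp a) =1 wact a.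
Proof. by apply: wact_equiv; apply/(cox_presents c)/eqP/(xchooseP (ex_word _)). Qed.

Lemma actM g h x : act (g * h)%g x = act g (act h x).
Proof.
have [a <-] := cox_generates c g; have [b <-] := cox_generates c h.
by rewrite -wp_cat !act_wp wact_cat.
Qed.

Lemma act1 x : act 1%g x = x.
Proof. by rewrite -wp_nil act_wp. Qed.

Lemma act_gen s x : act (c s) x = refl (alpha s) x.
Proof. by rewrite -wp1 act_wp. Qed.

Lemma actK g x : act g^-1%g (act g x) = x.
Proof. by rewrite -actM mulVg act1. Qed.

Lemma actKV g x : act g (act g^-1%g x) = x.
Proof. by rewrite -actM mulgV act1. Qed.

Lemma form_act g x y : form (act g x) (act g y) = form x y.
Proof.
have [a <-] := cox_generates c g; rewrite !act_wp.
by elim: a => //= s a; rewrite form_refl.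
Qed.

Lemma form_act_adj g x y : form (act g x) y = form x (act g^-1%g y).
Proof. by rewrite -{2}(actK g x) form_act. Qed.

Lemma act_oppv g x : act g (oppv x) = oppv (act g x).
Proof. by apply: form_inj => y; rewrite !(form_act_adj, formNl). Qed.

Lemma act_gen_alpha s : act (c s) (alpha s) = oppv (alpha s).
Proof. by rewrite act_gen refl_self. Qed.

(** Membership in the cone spanned by the simple roots, phrased through the
    linear form attached to the vector: the simple roots may be linearly
    dependent, so coefficients are not unique. *)
Definition simple_comb be := exists k : S -> R,
  (forall s, 0 <= k s) /\ forall x, form be x = \sum_s k s * form (alpha s) x.

Lemma simple_comb_alpha s : simple_comb (alpha s).
Proof.
exists (fun t => (t == s)%:R); split=> [t|x]; first by case: eqP.
rewrite (bigD1 s) //= eqxx mul1r big1 ?addr0 // => t /negbTE ->.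
by rewrite mul0r.
Qed.

Lemma simple_comb_lin (p q : R) be be' : 0 <= p -> 0 <= q ->
  simple_comb be -> simple_comb be' ->
  simple_comb (addv (scalev p be) (scalev q be')).
Proof.
move=> p0 q0 [k [k0 hk]] [k' [k'0 hk']].
exists (fun s => p * k s + q * k' s); split=> [s|x].
  by rewrite addr_ge0 // mulr_ge0.
rewrite formDl !formZl hk hk' !mulr_sumr -big_split /=.
by apply: eq_bigr => s _; ring.
Qed.

(** The rank two step of Tits' argument: moving from [w] along the dihedral
    coset of [s] and [t] as long as the length drops ends at an element [v] for
    which both simple roots are sent into the cone, and the coordinates of
    the image of [alpha s] are then values of Chebyshev polynomials, which are
    nonnegative because the descent is shorter than half of the braid relator. *)
Lemma dihedral_descent w s t : s != t -> len (w * c s)%g = (len w).+1 ->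
  (forall v r, (len v < len w)%N -> len (v * c r)%g = (len v).+1 ->
     simple_comb (act v (alpha r))) ->
  forall n j, let v := (w * wp (alt t s j))%g in
  let a := if odd j then t else s in let b := if odd j then s else t in
  let C := - form (alpha s) (alpha t) in
  (0 < j)%N -> len v = n -> len w = (n + j)%N ->
  act w (alpha s) = addv (scalev (cheb C j.+1) (act v (alpha a)))
                         (scalev (cheb C j) (act v (alpha b))) ->
  simple_comb (act w (alpha s)).
Proof.
move=> st ws IH; elim=> [|n IHn] j v a b C j0 lv lw e.
all: have next : (w * wp (alt t s j.+1))%g = (v * c b)%g
  by rewrite alt_rcons -cats1 wp_cat wp1 mulgA.
all: have prev : (v * c a)%g = (w * wp (alt t s j.-1))%g
  by (rewrite /v /a; case: (j) j0 => // p _;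
      rewrite alt_rcons -cats1 wp_cat wp1 mulgA /= if_neg genK).
all: have la : len (v * c a)%g = (len v).+1
  by (have := lenM (v * c a)%g (wp (alt t s j.-1))^-1%g;
      rewrite {1}prev mulgK lenV; have := len_le (alt t s j.-1);
      rewrite size_alt; have := len_mul_gen v a; lia).
all: have jk k : m s t = Some k -> (j < k)%N
  by move=> E; apply: (braid_descent_bound st E ws); rewrite -/v lw lv.
all: have C0 : 0 <= cheb C j /\ 0 <= cheb C j.+1
  by (case E : (m s t) => [k|];
    [have [_ h] := lp_finite P st E; have jk' := jk _ E; split; apply: h; lia
    |have h := lp_infinite P st E; split; apply: cheb_ge0; rewrite /C; lra]).
all: have stop : len (v * c b)%g = (len v).+1 -> simple_comb (act w (alpha s))
  by (move=> lb; rewrite e; case: C0 => *; apply: simple_comb_lin => //;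
      apply: IH => //; lia).
  by apply: stop; have := len_mul_gen v b; lia.
have [//|lb] := len_mul_gen v b.
apply: (IHn j.+1) => //; rewrite ?next; [lia | lia |].
clearbody v; rewrite e !(actM v) !act_gen; apply: form_inj => y.
rewrite [odd j.+1]/= !if_neg -/a -/b [cheb _ j.+2]chebSS -/C.
rewrite !(formDl, formZl) !(form_act_adj v) !form_refll unitA.
have -> : form (alpha a) (alpha b) = - C.
  by rewrite /a /b /C; case: odd; rewrite ?(formC (alpha t)) opprK.
by ring.
Qed.

(** Tits' theorem. By induction on the length, the images of the simple roots are
    already known to lie in the cone at the bottom of the dihedral coset of [w]
    that is generated by [s] and a descent of [w]. *)
Theorem ascent_comb w s : len (w * c s)%g = (len w).+1 ->
  simple_comb (act w (alpha s)).
Proof.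
have [n le_n] := ubnP (len w); elim: n w s le_n => // n IH w s le_n ws.
case: (pselect (w = 1%g)) => [->|/descent_exists [t wt]].
  by rewrite act1; apply: simple_comb_alpha.
have st : s != t by apply/eqP => est; move: wt; rewrite -est ws; lia.
apply: (@dihedral_descent w s t st ws _ (len (w * c t)%g) 1) => //.
- by move=> v r lt_v; apply: IH; lia.
- by rewrite /= wp1.
- by rewrite -wt addn1.
rewrite /= wp1 !actM !act_gen; apply: form_inj => y.
rewrite !(formDl, formZl) !(form_act_adj w) !form_refll unitA.
rewrite /=; ring.
Qed.

Definition root be := exists g s, be = act g (alpha s).

Lemma root_alpha s : root (alpha s).
Proof. by exists 1%g, s; rewrite act1. Qed.

Lemma root_act g be : root be -> root (act g be).
Proof. by case=> h [s ->]; exists (g * h)%g, s; rewrite actM. Qed.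

Lemma root_oppv be : root be -> root (oppv be).
Proof.
case=> h [s ->]; exists (h * c s)%g, s.
by rewrite actM act_gen_alpha act_oppv.
Qed.

Lemma root_unit be : root be -> form be be = 1.
Proof. by case=> g [s ->]; rewrite form_act unitA. Qed.

Lemma root_reflection be : root be -> exists r, forall x, act r x = refl be x.
Proof.
case=> g [s ->]; exists (g * c s * g^-1)%g => x.
rewrite !actM act_gen; apply: form_inj => y.
rewrite form_act_adj !form_refll form_act (form_act_adj g^-1%g x) invgK.
by rewrite (form_act_adj g (alpha s)).
Qed.

(** As simple roots make obtuse angles, the norm is at most the sum of the squares
    of the coefficients, so these cannot add up to less than [1]. *)
Lemma simple_comb_height be : form be be = 1 -> simple_comb be ->
  sigma <= form base be.
Proof.
move=> hb [k [k0 hk]]; rewrite formC hk.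
have -> : \sum_s k s * form (alpha s) base = sigma * \sum_s k s.
  rewrite mulr_sumr; apply: eq_bigr => s _.
  by rewrite formC (lp_height P) mulrC.
rewrite -[leLHS]mulr1 ler_pM2l ?(lp_sigma P) // leNgt; apply/negP => lt1.
have le_k s : k s <= \sum_t k t.
  by rewrite (bigD1 s) //= lerDl sumr_ge0.
have : form be be <= \sum_s k s.
  rewrite {1}hk; apply: ler_sum => s _; rewrite -[leRHS]mulr1 ler_wpM2l //.
  rewrite formC hk (bigD1 s) //= unitA mulr1.
  have : \sum_(t | t != s) k t * form (alpha t) (alpha s) <= 0.
    by apply: sumr_le0 => t ts; rewrite mulr_ge0_le0 // alpha_obtuse.
  by have := le_k s; lra.
by rewrite hb; lra.
Qed.

Lemma ascent_height w s : len (w * c s)%g = (len w).+1 ->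
  sigma <= form base (act w (alpha s)).
Proof.
by move=> h; apply: simple_comb_height; rewrite ?form_act ?unitA //; apply: ascent_comb.
Qed.

Lemma descent_height w s : (len (w * c s)%g).+1 = len w ->
  form base (act w (alpha s)) <= - sigma.
Proof.
move=> h; have := @ascent_height (w * c s)%g s; rewrite genK -h.
by rewrite actM act_gen_alpha act_oppv formNr => /(_ erefl); lra.
Qed.

Lemma root_height be : root be ->
  sigma <= form base be \/ form base be <= - sigma.
Proof.
case=> g [s ->]; case: (len_mul_gen g s) => h.
  by left; apply: ascent_height.
by right; apply: descent_height.
Qed.

Lemma root_comb be : root be -> 0 < form base be -> simple_comb be.
Proof.
case=> g [s ->]; case: (len_mul_gen g s) => h; first by move=> _; apply: ascent_comb.
by have := descent_height h; have := lp_sigma P; lra.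
Qed.

(** If both [be] and minus its reflection were in the cone, their sum would be a
    multiple of [alpha s]; pairing this relation with the base point and with
    [alpha s] leaves no room for the other simple roots. *)
Lemma refl_simple_pos be s : root be -> 0 < form base be ->
  be <> alpha s -> 0 < form base (refl (alpha s) be).
Proof.
move=> rb pb ne; have s0 := lp_sigma P.
have rr : root (refl (alpha s) be) by rewrite -act_gen; apply: root_act.
case: (root_height rr) => h; first lra.
case: ne.
have [k [k0 hk]] := root_comb rb pb.
have [||d [d0 hd]] := @root_comb (oppv (refl (alpha s) be)).
- exact: root_oppv.
- by rewrite formNr; lra.
set K := 2 * form be (alpha s).
have e x : \sum_t (k t + d t) * form (alpha t) x = K * form (alpha s) x.
  have := hd x; rewrite formNl form_refll => h'.
  under eq_bigr do rewrite mulrDl.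
  by rewrite big_split /= -hk -h' /K; ring.
have eb : \sum_t (k t + d t) = K.
  have := e base; rewrite [form (alpha s) _]formC (lp_height P).
  under eq_bigr do rewrite formC (lp_height P).
  by rewrite -mulr_suml; apply: mulIf; rewrite gt_eqF.
have e0 : \sum_t (k t + d t) * (1 - form (alpha t) (alpha s)) = 0.
  under eq_bigr do rewrite mulrBr mulr1.
  by rewrite sumrB eb e unitA; ring.
have z t : t != s -> k t = 0.
  move=> ts; have ob := alpha_obtuse ts.
  have le0 r : 0 <= (k r + d r) * (1 - form (alpha r) (alpha s)).
    apply: mulr_ge0; first by rewrite addr_ge0.
    by case: (eqVneq r s) => [->|/alpha_obtuse]; rewrite ?unitA; lra.
  have /eqP := e0; rewrite psumr_eq0 // => /allP /(_ t (mem_index_enum t)).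
  by have := k0 t; have := d0 t; move=> a b /= /eqP; nra.
have hs x : form be x = k s * form (alpha s) x.
  by rewrite hk (bigD1 s) //= big1 ?addr0 // => t /z ->; rewrite mul0r.
have k1 : k s = 1.
  have := root_unit rb; rewrite hs formC hs unitA mulr1 -expr2 => /eqP.
  by rewrite sqrf_eq1 => /orP [/eqP //|/eqP k1]; have := k0 s; rewrite k1; lra.
by apply: form_inj => x; rewrite hs k1 mul1r.
Qed.


(** * Cone types and separating lines *)

Lemma cone_typeE w v : cone_type c w v <-> len (w * v)%g = (len w + len v)%N.
Proof.
rewrite /cone_type /cone /cox_dist /=; split.
  case=> x /=; rewrite !invg1 !mul1g => e <-.
  by rewrite mulgA mulgV mul1g.
move=> e; exists (w * v)%g => /=; last by rewrite mulgA mulVg mul1g.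
by rewrite !invg1 !mul1g mulgA mulVg mul1g.
Qed.

(** The centre of the circle inscribed in the chamber of [g] stands for the chamber:
    it never lies on a root line. *)
Definition centre g := act g base.

Lemma centre_form g be : form (centre g) be = form base (act g^-1%g be).
Proof. by rewrite /centre form_act_adj. Qed.

Lemma centre_root g be : root be ->
  sigma <= form (centre g) be \/ form (centre g) be <= - sigma.
Proof. by move=> rb; rewrite centre_form; apply: root_height; apply: root_act. Qed.

Lemma centre_nonneg g be : root be -> 0 <= form (centre g) be ->
  0 < form (centre g) be.
Proof. by move=> /(centre_root g) [] h; have := lp_sigma P; lra. Qed.

Lemma centre_nonpos g be : root be -> form (centre g) be <= 0 ->
  form (centre g) be < 0.
Proof. by move=> /(centre_root g) [] h; have := lp_sigma P; lra. Qed.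

Lemma centreM g h : centre (g * h)%g = act g (centre h).
Proof. by rewrite /centre actM. Qed.

Lemma centre_act h g be : form (centre h) (act g be) = form (centre (g^-1 * h)%g) be.
Proof. by rewrite centreM formC form_act_adj formC. Qed.

Lemma centre1 : centre 1%g = base.
Proof. by rewrite /centre act1. Qed.

(** By [refl_simple_pos], adjacent chambers are separated by one line only. *)
Lemma crossed_root v s be : root be -> 0 < form (centre v) be ->
  form (centre (v * c s)%g) be < 0 -> be = act v (alpha s).
Proof.
move=> rb; rewrite !centre_form invgM genV actM act_gen => p n.
have rv : root (act v^-1%g be) by apply: root_act.
case: (pselect (act v^-1%g be = alpha s)) => [<-|ne].
  by rewrite actKV.
by have := lt_trans (refl_simple_pos rv p ne) n; rewrite ltxx.
Qed.

Lemma inversion_prefix v be : root be -> 0 < form base be ->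
  form (centre v) be < 0 ->
  exists v' s, (len v' < len v)%N /\ be = act v' (alpha s).
Proof.
move=> rb pb; have [n le_n] := ubnP (len v); elim: n v le_n => // n IH v le_n nv.
case: (pselect (v = 1%g)) => [e|/descent_exists [s vs]].
  by move: nv; rewrite e centre1; lra.
case: (centre_root (v * c s)%g rb) => h; last first.
  have [||v' [t [lt e]]] := IH (v * c s)%g; [lia | by have := lp_sigma P; lra |].
  by exists v', t; split=> //; lia.
exists (v * c s)%g, s; split; first lia.
apply: crossed_root => //; first by have := lp_sigma P; lra.
by rewrite genK.
Qed.

(** A gallery from [w^-1] to [1] followed by one from [1] to [v] is minimal iff it
    crosses no line twice, that is, iff no line separates [1] from both ends. *)
Lemma cone_type_separation w v : cone_type c w v <->
  ~ exists be, [/\ root be, 0 < form base be, form (centre w^-1%g) be < 0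
                & form (centre v) be < 0].
Proof.
have s0 := lp_sigma P.
rewrite cone_typeE; have [n le_n] := ubnP (len v); elim: n v le_n => // n IH v le_n.
case: (pselect (v = 1%g)) => [->|/descent_exists [s vs]].
  rewrite mulg1 len1 addn0; split=> // _ [be [_ pb _]].
  by rewrite centre1; lra.
set v' := (v * c s)%g in vs.
have ev : (v' * c s)%g = v by rewrite genK.
have up : (len (v' * c s)%g = (len v').+1)%N by rewrite ev.
clearbody v'.
have lt_v' : (len v' < n)%N by lia.
have tri := lenM w v'; have tri2 := len_mul_gen (w * v')%g s.
rewrite -mulgA ev in tri2.
have {IH} IH := IH v' lt_v'.
split=> [e|no_sep].
- case=> be [rb pb nw nv].
    have e' : (len (w * v')%g = len w + len v')%N.
    move: tri tri2 e vs.
    by move: (len (w * v')%g) (len (w * v)%g) (len v) (len v'); lia.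
  case: (centre_root v' rb) => h; last first.
    by apply: (proj1 IH e'); exists be; split=> //; lra.
  have eb : be = act v' (alpha s).
    by apply: crossed_root => //; [lra | rewrite ev].
  have : sigma <= form base (act (w * v')%g (alpha s)).
    by apply: ascent_height; rewrite -mulgA ev e e' -vs addnS.
  rewrite actM -eb => h'; move: nw; rewrite centre_form invgK; lra.
- have e' : (len (w * v')%g = len w + len v')%N.
    apply/IH => -[be [rb pb nw nv]]; apply: no_sep; exists be; split=> //.
    case: (centre_root v rb) => // h; last lra.
    have : oppv be = act v' (alpha s).
      apply: crossed_root; first exact: root_oppv.
        by rewrite formNr; lra.
      by rewrite ev formNr; lra.
    move/(congr1 (form base)); rewrite formNr.
    by have := ascent_height up; lra.
  case: tri2 => h; first by rewrite h e' -vs addnS.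
  case: no_sep; exists (act v' (alpha s)); split.
  + by exists v', s.
  + by have := ascent_height up; lra.
  + rewrite centre_form invgK -actM.
    have := @descent_height (w * v')%g s.
    by rewrite -mulgA ev => /(_ h); lra.
  + rewrite -ev centre_act mulgA mulVg mul1g centre_form genV act_gen_alpha.
    by rewrite formNr (lp_height P); lra.
Qed.

(** * Finitely many lines determine the cone type *)

(** Each crossing of a line moves the centre of the chamber up by at least
    [2 * sigma ^+ 2]. *)
Lemma centre_height g : 1 + 2 * sigma ^+ 2 * (len g)%:R <= (centre g).2.
Proof.
have s0 := lp_sigma P.
have [n le_n] := ubnP (len g); elim: n g le_n => // n IH g le_n.
case: (pselect (g = 1%g)) => [->|/descent_exists [s gs]].
  by rewrite centre1 len1 /=; lra.
have {}IH := IH (g * c s)%g ltac:(lia).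
set v := (g * c s)%g in gs IH.
have eg : g = (v * c s)%g by rewrite genK.
clearbody v.
have up : (len (v * c s)%g = (len v).+1)%N by rewrite -eg -gs.
have := ascent_height up.
have e : form base (centre g) =
    form base (centre v) - 2 * sigma * form base (act v (alpha s)).
  rewrite eg centreM formC form_act_adj [centre (c s)]act_gen form_refll.
  by rewrite (lp_height P) -!form_act_adj -/(centre v) (formC (act v _)) (formC (centre v)).
move: e IH; rewrite !form_base -gs -natr1 => e IH h; nra.
Qed.

Lemma hyp_centre g : hyp (centre g).
Proof.
split; first by rewrite /centre form_act; have [] := hyp_base R.
have := centre_height g; have := ler0n R (len g); have := lp_sigma P.
by move: (len g)%:R => l; nra.
Qed.

Fixpoint words (n : nat) : seq (seq S) :=
  if n is p.+1 then [::] :: [seq s :: a | s <- enum S, a <- words p] else [:: [::]].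

Lemma mem_words n a : (size a <= n)%N -> a \in words n.
Proof.
elim: n a => [|n IH] [|s a] //= h; rewrite inE //=.
by apply/allpairsP; exists (s, a); rewrite mem_enum IH.
Qed.

Definition roots_upto n : seq (vec R) :=
  [seq wact a (alpha s) | a <- words n, s <- enum S].

Lemma roots_upto_root n be : be \in roots_upto n -> root be.
Proof.
by case/allpairsP => -[a s] /= [_ _ ->]; exists (wp a), s; rewrite act_wp.
Qed.

Lemma mem_roots_upto n v s : (len v <= n)%N -> act v (alpha s) \in roots_upto n.
Proof.
have [a [<- <-]] := lenP v => h; rewrite act_wp.
by apply/allpairsP; exists (a, s); rewrite mem_words // mem_enum.
Qed.

(** The reflection in a line at bounded distance moves the base point by a bounded
    amount, so it has bounded length, and its root is one of its inversions. *)
Lemma finitely_many_low_roots (K : R) :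
  exists n, forall be, root be -> 0 < form base be -> form base be <= K ->
    be \in roots_upto n.
Proof.
have s0 := lp_sigma P.
exists (Num.bound (K ^+ 2 / sigma ^+ 2)) => be rb pb leK.
have [r hr] := root_reflection rb; have ub := root_unit rb.
have hb : act r be = oppv be by rewrite hr refl_self.
(* the reflection exchanges the two sides of its line *)
have nr : form (centre r) be < 0.
  by rewrite -[be in form _ be]oppvK -hb formNr /centre form_act; lra.
have [v [s [lt_v ->]]] := inversion_prefix rb pb nr.
apply: mem_roots_upto; apply: ltnW; apply: leq_trans lt_v _.
rewrite -(ler_nat R); apply: ltW; apply: le_lt_trans (_ : _ <= K ^+ 2 / sigma ^+ 2) _.
  rewrite ler_pdivlMr ?exprn_gt0 //.
  have := centre_height r; rewrite -[(centre r).2]opprK -form_base /centre hr.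
  rewrite form_reflr (form_base base) /= => h.
  have : form base be ^+ 2 <= K ^+ 2 by rewrite ler_sqr ?nnegrE //; lra.
  by move: h; move: (len r)%:R => l; nra.
apply: archi_boundP.
by rewrite divr_ge0 ?sqr_ge0.
Qed.


Lemma alpha_height s : (alpha s).2 = - sigma.
Proof. by rewrite -(lp_height P s) form_base opprK. Qed.

Definition low_bound : R := sigma + (eta - sigma)^-1.

(** A line far from the base point lies behind the line of a simple root: seen
    from the base point it occupies a small visual angle, and the polygon is
    compact ([sigma < eta]). The common point required to compare the two
    half-planes is the point of tangency. *)
Lemma high_root_dominates be : root be -> low_bound < form base be ->
  exists s, forall g, form (centre g) be < 0 -> form (centre g) (alpha s) < 0.
Proof.
move=> rb; have s0 := lp_sigma P; have es := lp_eta P.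
rewrite form_base; set h := - be.2 => lo.
have lo1 : sigma < h.
  by apply: le_lt_trans lo; rewrite lerDl invr_ge0 subr_ge0 ltW.
have lo2 : 1 < (eta - sigma) * h.
  rewrite -ltr_pdivrMl; last lra.
  by rewrite mulr1; apply: le_lt_trans lo; rewrite lerDr ltW.
have [s hs] := lp_spread P be; exists s => g gb.
apply: centre_nonpos; first exact: root_alpha.
have nb := unit_norm (root_unit rb); have nb0 := flat_norm_ge0 be.
have na := unit_norm (lp_unit P s); have na0 := flat_norm_ge0 (alpha s).
rewrite alpha_height in na.
have hb : be.2 = - h by rewrite opprK.
have cau : form (alpha s) be <= flat_norm (alpha s) * flat_norm be - sigma * h.
  have := flat_cauchy (alpha s) be; rewrite ler_norml => /andP [_].
  by rewrite /form alpha_height hb; lra.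
have far : 1 <= form (alpha s) be.
  have : h <= flat_norm be by rewrite hb in nb; nra.
  by move: hs; rewrite /form alpha_height hb; nra.
have tang : 0 < h - sigma * form (alpha s) be.
  rewrite hb in nb; move: cau na na0 nb nb0.
  set N := flat_norm (alpha s); set M := flat_norm be => cau na na0 nb nb0.
  have : sigma * M < N * h.
    rewrite -ltr_sqr ?nnegrE; try by apply: mulr_ge0 => //; lra.
    by rewrite !exprMn na nb; nra.
  move=> lt; have N0 : 0 < N by nra.
  have pos : 0 < N * (N * h - sigma * M) by apply: mulr_gt0 => //; lra.
  have up : sigma * form (alpha s) be <= sigma * (N * M - sigma * h).
    by rewrite ler_wpM2l // ltW.
  nra.
set k := (Num.sqrt (1 + sigma ^+ 2))^-1.
have k0 : 0 < k by rewrite invr_gt0 sqrtr_gt0; nra.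
have k2 : k ^+ 2 * (1 + sigma ^+ 2) = 1.
  by rewrite exprVn sqr_sqrtr ?mulVf //; nra.
(* the point at which the side of [s] touches the inscribed circle *)
pose y := scalev k (addv base (scalev (- sigma) (alpha s))).
apply: (@disjoint_half_planes _ (oppv be) (alpha s) (centre g) y).
- by rewrite formNl formNr opprK root_unit.
- exact: lp_unit P s.
- by rewrite formNl formC; lra.
- split.
    rewrite /y formZl formZr !(formDl, formDr, formZl, formZr) (lp_unit P).
    rewrite (formC (alpha s) base) (lp_height P) form_base /=; nra.
  by rewrite /y /= alpha_height; nra.
- rewrite formNr /y formZl formDl formZl form_base -/h.
  by rewrite oppr_lt0 mulr_gt0 //; lra.
- by rewrite /y formZl formDl formZl (lp_unit P) (lp_height P); nra.
- exact: hyp_centre.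
- by rewrite formNr; lra.
Qed.

(** In [cone_type_separation] a line that is far from the base point can be replaced
    by the line of a simple root, by [high_root_dominates]. *)
Lemma finite_type_test : exists E : seq (vec R),
  (forall be, be \in E -> root be) /\
  forall w w', {in E, forall be, (0 < form (centre w^-1%g) be) =
                                 (0 < form (centre w'^-1%g) be)} ->
    cone_type c w = cone_type c w'.
Proof.
have [n hn] := finitely_many_low_roots low_bound.
exists (roots_upto n); split; first exact: roots_upto_root.
suff sub w w' : {in roots_upto n, forall be, (0 < form (centre w^-1%g) be) =
      (0 < form (centre w'^-1%g) be)} -> (cone_type c w `<=` cone_type c w')%classic.
  by move=> w w' e; apply/seteqP; split; apply: sub => // be /e ->.
move=> e v /cone_type_separation no_sep; apply/cone_type_separation.
case=> be [rb pb nw nv].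
have [ga [rg pg lg nw' nv']] : exists ga, [/\ root ga, 0 < form base ga,
    form base ga <= low_bound, form (centre w'^-1%g) ga < 0 & form (centre v) ga < 0].
  case: (leP (form base be) low_bound) => le; first by exists be.
  have [s hs] := high_root_dominates rb le.
  exists (alpha s); split; [exact: root_alpha | | | exact: hs | exact: hs].
    by rewrite (lp_height P); apply: lp_sigma P.
  rewrite (lp_height P) /low_bound lerDl invr_ge0.
  by have := lp_eta P; lra.
apply: no_sep; exists ga; split=> //.
have := e _ (hn _ rg pg lg); rewrite [X in _ = X]ltNge ltW //= => /negbT.
by rewrite -leNgt; apply: centre_nonpos.
Qed.

(** Only the lines between [1] and [w^-1] matter in [cone_type_separation]. *)
Lemma type_half_planes w : exists E : seq (vec R),
  (forall be, be \in E -> root be) /\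
  forall v, cone_type c w v <-> {in E, forall be, 0 < form (centre v) be}.
Proof.
exists [seq be <- roots_upto (len w) |
         (0 < form base be) && (form (centre w^-1%g) be < 0)].
split=> [be|v]; first by rewrite mem_filter => /andP [_ /roots_upto_root].
rewrite cone_type_separation; split=> [no_sep be|pos [be [rb pb nw nv]]].
  rewrite mem_filter => /andP [/andP [pb nw] /roots_upto_root rb].
  rewrite ltNge; apply/negP => nv; apply: no_sep; exists be; split=> //.
  exact: centre_nonpos.
have [v' [s [lt e]]] := inversion_prefix rb pb nw.
have : be \in roots_upto (len w).
  by rewrite e; apply: mem_roots_upto; rewrite -(lenV w) ltnW.
move=> be_in; have := pos be; rewrite mem_filter pb nw be_in => /(_ isT) h.
by have := lt_trans h nv; rewrite ltxx.
Qed.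

(** * Half-planes inside intersections of half-planes *)

Lemma hyp_act g y : hyp y -> hyp (act g y).
Proof.
move=> hy; split; first by rewrite form_act; have [] := hy.
rewrite -oppr_lt0 -form_base formC form_act_adj formC.
by have /andP [] := hyp_form_bounds (hyp_centre g^-1%g) hy.
Qed.

(** By compactness, from any point that is high enough some side of the base polygon
    faces the point, and reflecting in that side lowers the point by at least
    [2 * sigma]. *)
Lemma coarse_density : exists2 K : R, 1 <= K &
  forall y, hyp y -> exists w, (act w^-1%g y).2 <= K.
Proof.
have s0 := lp_sigma P; have es := lp_eta P.
have d0 : 0 < eta - sigma by lra.
pose K := (eta + 1) / (eta - sigma).
have Kd : K * (eta - sigma) = eta + 1 by rewrite mulfVK // gt_eqF.
have K1 : 1 <= K by rewrite ler_pdivlMr // mul1r; lra.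
exists K => // y hy.
have [n] : exists n : nat, y.2 <= K + 2 * sigma * n%:R.
  exists (Num.bound (y.2 / (2 * sigma))).
  have : y.2 / (2 * sigma) < (Num.bound (y.2 / (2 * sigma)))%:R.
    by apply: archi_boundP; rewrite divr_ge0 ?mulr_ge0 // ltW // hy.2.
  by rewrite ltr_pdivrMr ?mulr_gt0 // => h; lra.
elim: n y hy => [|n IH] y hy le_y.
  by exists 1%g; rewrite invg1 act1; rewrite mulr0 addr0 in le_y.
have [le|gt] := leP y.2 K; first by exists 1%g; rewrite invg1 act1.
have [s hs] := lp_spread P (oppv y).
have nop : flat_norm (oppv y) = flat_norm y.
  by rewrite /flat_norm /=; congr Num.sqrt; ring.
have fa : form y (alpha s) <= -1.
  have y1 : y.2 - 1 <= flat_norm y.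
    have := hyp_norm hy; have := flat_norm_ge0 y; have := hyp_height_ge1 hy.
    by nra.
  move: hs; rewrite nop /form alpha_height /= => hs; nra.
have [||w hw] := IH (act (c s) y); first exact: hyp_act.
  by rewrite act_gen /= alpha_height; move: le_y; rewrite -natr1; nra.
by exists (c s * w)%g; rewrite invgM genV actM.
Qed.

Lemma unit_direction be : form be be = 1 ->
  let n := flat_norm be in
  [/\ 0 < n, `|be.2| < n & (be.1.1 / n) ^+ 2 + (be.1.2 / n) ^+ 2 = 1].
Proof.
move=> ub n; have nn := unit_norm ub; have n0 := flat_norm_ge0 be.
have np : 0 < n by rewrite /n; have := sqr_ge0 be.2; nra.
split=> //.
  by rewrite -ltr_sqr ?nnegrE // real_normK ?num_real // nn ltrDr.
by rewrite !expr_div_n -mulrDl -sqr_flat_norm mulfV // gt_eqF // exprn_gt0.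
Qed.

(** Take a chamber near a far point of the ray from the base point perpendicular to
    the line. *)
Lemma deep_chamber be (T : R) : form be be = 1 -> exists w, form (centre w) be <= - T.
Proof.
move=> ub; have [K K1 dens] := coarse_density.
have [n0 hn pq] := unit_direction ub.
set n := flat_norm be in n0 hn pq; set h := be.2 in hn.
set p := _ / n in pq; set q := _ / n in pq.
have ep : p * n = be.1.1 by rewrite /p mulfVK // gt_eqF.
have eq : q * n = be.1.2 by rewrite /q mulfVK // gt_eqF.
have nh : 0 < n + h /\ 0 < n - h by move: hn; rewrite ltr_norml => /andP; lra.
set M := K * (1 + 2 * `|T|).
have M0 : 0 <= M by rewrite mulr_ge0 //; have := normr_ge0 T; lra.
pose l := 1 + (2 * M + (n - h)) / (n + h).
have l1 : 1 <= l by rewrite lerDl divr_ge0 //; lra.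
have lM : 2 * M + (n - h) < l * (n + h).
  have e : (2 * M + (n - h)) / (n + h) * (n + h) = 2 * M + (n - h).
    by rewrite mulfVK // gt_eqF //; lra.
  by rewrite /l [ltRHS]mulrDl e; lra.
have hy : hyp (ray (- p) (- q) l) by apply: hyp_ray; [rewrite !sqrrN | lra].
have [w hw] := dens _ hy; exists w; rewrite leNgt; apply/negP => lt.
set y' := act _ _ in hw; have hy' : hyp y' by apply: hyp_act.
set be' := act w^-1%g be.
have ub' : form be' be' = 1 by rewrite form_act.
have fy : form y' be' < - M.
  rewrite /y' /be' form_act form_ray !opprK.
  have -> : form (ideal (- p) (- q)) be = - (n + h).
    transitivity (- (p ^+ 2 + q ^+ 2) * n - h); last by rewrite pq; ring.
    by rewrite /form /= -ep -eq -/h; ring.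
  have -> : form (ideal p q) be = n - h.
    transitivity ((p ^+ 2 + q ^+ 2) * n - h); last by rewrite pq; ring.
    by rewrite /form /= -ep -eq -/h; ring.
  have li : l^-1 <= 1 by rewrite invf_le1; lra.
  have : l^-1 * (n - h) <= n - h by rewrite ger_pMl //; lra.
  lra.
have fb : - T < form base be' by rewrite /be' -centre_form.
rewrite form_base in fb; set H := be'.2 in fb.
have ny := hyp_norm_lt hy'; have nb := unit_norm ub'.
have := flat_cauchy y' be'; rewrite ler_norml => /andP [cau _].
move: fy; rewrite {1}/form -/H => fy.
have y0 := hy'.2; have ny0 := flat_norm_ge0 y'; have nb0 := flat_norm_ge0 be'.
have nb1 : flat_norm be' <= 1 + `|H|.
  rewrite -ler_sqr ?nnegrE ?addr_ge0 // nb -/H -(real_normK (num_real H)).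
  by have := normr_ge0 H; nra.
have up : flat_norm y' * flat_norm be' <= y'.2 * (1 + `|H|).
  by apply: ler_pM => //; apply: ltW.
have T0 := ler_norm T.
case: (lerP 0 H) => hH.
  rewrite ger0_norm // in up.
  have : y'.2 * (1 + 2 * H) <= K * (1 + 2 * `|T|) by apply: ler_pM => //; lra.
  by rewrite -/M; lra.
rewrite ltr0_norm // in up; have : K <= M by rewrite /M ler_peMr //; [lra | have := normr_ge0 T; lra].
lra.
Qed.

(** From a chamber [w] deep in the first half-plane, go away from its boundary, and
    choose a translate of the second line that passes within bounded distance
    of a far point of this ray. It turns away from the first line, and
    its distance to [w] is bounded below like that of all root lines, which
    suffices because [w] is deep. *)
Lemma translate_inside be de : root be -> root de -> exists h,
  forall g, 0 < form (centre g) (act h de) -> form (centre g) be < 0.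
Proof.
move=> rb rd; have s0 := lp_sigma P.
have [K K1 dens] := coarse_density.
have [w deep] := deep_chamber sigma^-1 (root_unit rb).
set be' := act w^-1%g be.
have ub' : form be' be' = 1 by rewrite form_act root_unit.
have [n0 hn pq] := unit_direction ub'.
set n := flat_norm be' in n0 hn pq; set hb := be'.2 in hn.
set p := _ / n in pq; set q := _ / n in pq.
have ep : p * n = be'.1.1 by rewrite /p mulfVK // gt_eqF.
have eq : q * n = be'.1.2 by rewrite /q mulfVK // gt_eqF.
have hb0 : sigma^-1 <= hb.
  by rewrite -[hb]opprK -form_base lerNr -centre_form.
set K' := K * (flat_norm de + `|de.2|).
have K'0 : 0 <= K'.
  by rewrite mulr_ge0 ?addr_ge0 // ?flat_norm_ge0 //; lra.
pose l := 2 + 2 * K' / sigma.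
have ls : 2 * K' <= l * sigma.
  have e : 2 * K' / sigma * sigma = 2 * K' by rewrite mulfVK // gt_eqF.
  by rewrite /l [leRHS]mulrDl e; lra.
have l2 : 2 <= l by rewrite lerDl divr_ge0 ?(ltW s0) // mulr_ge0.
have hy : hyp (ray (- p) (- q) l) by apply: hyp_ray; [rewrite !sqrrN | lra].
have [g0 hg0] := dens _ hy.
have near : `|form (ray (- p) (- q) l) (act g0 de)| <= K'.
  rewrite formC form_act_adj formC; apply: form_low_bound => //.
  exact: hyp_act.
(* the reflection in the line of [de] provides both orientations *)
have [g [neg near']] : exists g, form base (act g de) <= - sigma /\
    `|form (ray (- p) (- q) l) (act g de)| <= K'.
  case: (root_height (root_act g0 rd)) => h; last by exists g0.
  have [r hr] := root_reflection rd.
  exists (g0 * r)%g; rewrite actM hr refl_self ?root_unit // act_oppv !formNr normrN.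
  by split=> //; lra.
set M := act g de in neg near'.
have uM : form M M = 1 by rewrite form_act root_unit.
set t := p * M.1.1 + q * M.1.2.
have t0 : t <= 0.
  move: near' neg; rewrite form_base form_ray !opprK ler_norml => /andP [lo _] H0.
  have li : l^-1 <= 1 by rewrite invf_le1; lra.
  have li0 : 0 < l^-1 by rewrite invr_gt0; lra.
  move: lo; rewrite /form /= => lo.
  have lo' : t * (l - l^-1) <= 2 * K' - M.2 * (l + l^-1) by rewrite /t; lra.
  rewrite leNgt; apply/negP => tp.
  have : 0 < t * (l - l^-1) by apply: mulr_gt0 => //; lra.
  have : sigma * l <= M.2 * (l + l^-1) by apply: ler_pM; lra.
  lra.
exists (w * g)%g => x pos; apply: centre_nonpos => //.
apply: (@disjoint_half_planes _ (act (w * g)%g de) be (centre x) (centre w)) => //.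
- by rewrite form_act root_unit.
- exact: root_unit.
- rewrite actM form_act_adj -/M -/be'.
  have -> : form M be' = n * t - hb * M.2.
    by rewrite /form -ep -eq /t -/hb; ring.
  move: neg; rewrite form_base => neg.
  have : 1 <= hb * M.2.
    have <- : sigma^-1 * sigma = 1 by rewrite mulVf // gt_eqF.
    by apply: ler_pM; rewrite ?invr_ge0; lra.
  have : n * t <= 0 by rewrite pmulr_rle0.
  lra.
- exact: hyp_centre.
- by rewrite centre_act invgM mulgVK centre_form invgK -/M; lra.
- by have : 0 < sigma^-1; [rewrite invr_gt0 | lra].
- exact: hyp_centre.
Qed.

(** The half-plane is cut off by a side of a chamber far away in a direction that is
    interior to the intersection, namely a side that faces away from the base
    point. *)
Lemma unbounded_contains_half_plane (E : seq (vec R)) :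
  (forall be, be \in E -> root be) ->
  (forall n, exists2 g, (n <= len g)%N & {in E, forall be, 0 < form (centre g) be}) ->
  exists de, [/\ root de, 0 < form base de &
    forall g, form (centre g) de < 0 -> {in E, forall be, 0 < form (centre g) be}].
Proof.
move=> rE unb; have s0 := lp_sigma P; have es := lp_eta P.
have [K K1 dens] := coarse_density.
pose D x := exists2 g, x = centre g & {in E, forall be, 0 < form (centre g) be}.
have Dh x : D x -> hyp x by case=> g -> _; apply: hyp_centre.
have uE : {in E, forall be, form be be = 1} by move=> be /rE; apply: root_unit.
have [||p [q [pq inner]]] := @interior_direction R D E sigma Dh _ s0 uE.
- move=> n; have [g gn pos] := unb (Num.bound (n%:R / (2 * sigma ^+ 2))).
  exists (centre g); first by exists g.
  have h1 := centre_height g.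
  have : n%:R / (2 * sigma ^+ 2) < (Num.bound (n%:R / (2 * sigma ^+ 2)))%:R.
    by apply: archi_boundP; rewrite divr_ge0 // mulr_ge0 // sqr_ge0.
  rewrite ltr_pdivrMr ?mulr_gt0 ?exprn_gt0 // => h2.
  have h3 : (Num.bound (n%:R / (2 * sigma ^+ 2)))%:R * (2 * sigma ^+ 2) <=
      (len g)%:R * (2 * sigma ^+ 2) by rewrite ler_wpM2r ?ler_nat // mulr_ge0 // sqr_ge0.
  lra.
- move=> x [g -> pos] be bE; case: (centre_root g (rE be bE)) => // h.
  by have := pos be bE; lra.
pose K' := K * (1 + 2 * sigma); pose k := sigma / (4 * K).
have k0 : 0 < k by rewrite divr_gt0 // mulr_gt0 //; lra.
have K'0 : 0 <= K' by rewrite mulr_ge0 //; lra.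
have [|e e0 far] := @near0_all R E (fun be e => forall a : vec R, form a a = 1 ->
    `|form (ray p q e^-1) a| <= K' -> k * e^-1 <= form base a ->
    forall x, hyp x -> form x a < 0 -> 0 <= form x be).
  move=> be bE; have [l0 hl] := far_half_plane pq (uE be bE) (inner be bE) K'0 k0.
  exists (1 + `|l0|)^-1 => [|e e0 elt]; first by rewrite invr_gt0 ltr_pwDl.
  apply: hl; apply: le_trans (ler_norm _) _.
  have : 1 + `|l0| < e^-1.
    by rewrite -[ltLHS]invrK ltf_pV2 // posrE invr_gt0 ltr_pwDl.
  lra.
have l0 : 0 < e^-1 by rewrite invr_gt0.
set l := e^-1 in far l0.
have hy := hyp_ray pq l0.
have [v hv] := dens _ hy.
have [s hs] := lp_spread P (act v^-1%g base).
set y' := act v^-1%g (ray p q l) in hv; set o' := act v^-1%g base in hs.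
have hy' : hyp y' by apply: hyp_act.
have ho' : hyp o' by apply: hyp_act; apply: hyp_base.
have near : `|form (ray p q l) (act v (alpha s))| <= K'.
  rewrite formC form_act_adj formC.
  apply: le_trans (form_low_bound _ hy' hv) _.
  rewrite ler_wpM2l //; first lra.
  have na := unit_norm (lp_unit P s); have na0 := flat_norm_ge0 (alpha s).
  rewrite alpha_height in na *; rewrite normrN gtr0_norm //; nra.
have high : k * l <= form base (act v (alpha s)).
  have -> : form base (act v (alpha s)) = form o' (alpha s).
    by rewrite formC form_act_adj formC.
  have h1 : sigma * o'.2 <= form o' (alpha s).
    move: hs; rewrite /form alpha_height => hs.
    by have : 0 <= eta * flat_norm o'; [rewrite mulr_ge0 ?flat_norm_ge0 //; lra | lra].
  have /andP [h2 _] := hyp_form_bounds hy' ho'.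
  have h3 : form y' o' <= - (l / 2).
    rewrite form_act formC form_base /=.
    by have : 0 < l^-1; [rewrite invr_gt0 | lra].
  have o0 := ho'.2.
  have h4 : y'.2 * o'.2 <= K * o'.2 by rewrite ler_wpM2r // ltW.
  have h5 : l <= 4 * K * o'.2 by lra.
  apply: le_trans h1; rewrite /k mulrAC ler_pdivrMr ?mulr_gt0 //; last lra.
  by rewrite -!mulrA ler_pM2l //; lra.
exists (act v (alpha s)); split.
- by exists v, s.
- by apply: lt_le_trans high; rewrite mulr_gt0.
move=> g ng be bE; apply: centre_nonneg; first exact: rE.
apply: (far be bE _ _ near high (centre g)) => //; last exact: hyp_centre.
by rewrite form_act (lp_unit P).
Qed.

(** * The Cannon automaton *)

(** Hence the type of [w * q] only depends on [q] and on the type of [w], which makes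
    the automaton deterministic. *)
Lemma type_mul w q v : cone_type c w q ->
  cone_type c (w * q)%g v <-> cone_type c w (q * v)%g /\ cone_type c q v.
Proof.
rewrite !cone_typeE => e; rewrite e -mulgA.
have := lenM w (q * v)%g; have := lenM q v.
by move: (len (w * (q * v))%g) (len (q * v)%g) (len w) (len q) (len v) => *; lia.
Qed.

Lemma type_mul_eq w w' q : cone_type c w = cone_type c w' -> cone_type c w q ->
  cone_type c (w * q)%g = cone_type c (w' * q)%g.
Proof.
move=> e wq; apply/predeqP => v.
by rewrite (type_mul _ wq) type_mul -?e.
Qed.

Local Notation G := (cannon_automaton c).

Lemma accessible_mul w T T' : accessible G T T' -> T = cone_type c w ->
  exists q, [/\ (0 < len q)%N, cone_type c w q & T' = cone_type c (w * q)%g].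
Proof.
move=> acc; elim: acc w => {T T'} [T T'|T T1 T2 _ ih1 _ ih2].
  case=> s [w0 [-> ->]] + w; rewrite /cox_dist !invg1 !mul1g => e ew.
  have l1 : len (c s) = 1%N.
    by have := len_gen s; have := lenM w0 (c s); rewrite e; lia.
  have w0s : cone_type c w0 (c s) by apply/cone_typeE; rewrite e l1 addn1.
  by exists (c s); rewrite l1 -ew; split=> //; apply: type_mul_eq.
move=> w /ih1 [q1 [l1 wq1 /ih2 [q2 [l2 wq2 ->]]]].
exists (q1 * q2)%g; rewrite mulgA.
have [h1 /cone_typeE h2] := (type_mul q2 wq1).1 wq2.
by rewrite h2 addn_gt0 l1.
Qed.

Lemma mul_accessible w q : (0 < len q)%N -> cone_type c w q ->
  accessible G (cone_type c w) (cone_type c (w * q)%g).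
Proof.
have [n le_n] := ubnP (len q); elim: n q le_n => // n IH q le_n q0 /cone_typeE wq.
case: (pselect (q = 1%g)) => [e|/descent_exists [s qs]].
  by move: q0; rewrite e len1.
set q' := (q * c s)%g in qs.
have eq : q = (q' * c s)%g by rewrite genK.
clearbody q'.
have up : len (w * q' * c s)%g = (len w + len q')%N.+1.
  by rewrite -mulgA -eq wq -qs addnS.
have wq' : len (w * q')%g = (len w + len q')%N.
  have := lenM w q'; have := len_mul_gen (w * q')%g s; rewrite up.
  by move: (len (w * q')%g) (len w) (len q'); lia.
have step : accessible G (cone_type c (w * q')%g) (cone_type c (w * q)%g).
  apply: t_step; exists s, (w * q')%g; rewrite eq mulgA; split=> //.
  by rewrite /cox_dist !invg1 !mul1g up wq'.
case: (posnP (len q')) => [z|pos].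
  by move: step; rewrite (len_eq0 z) mulg1.
apply: t_trans step; apply: IH => //; last exact/cone_typeE.
by rewrite -ltnS qs.
Qed.

Lemma recurrent_unbounded T n : recurrent G T ->
  exists w q, [/\ T = cone_type c w, (n <= len q)%N, cone_type c w q &
    T = cone_type c (w * q)%g].
Proof.
case=> -[w _ <-] acc.
suff [q [nq wq e]] : exists q, [/\ (n <= len q)%N, cone_type c w q &
    cone_type c w = cone_type c (w * q)%g] by exists w, q.
elim: n => [|n [q [nq wq e]]].
  by exists 1%g; rewrite mulg1; split=> //; apply/cone_typeE; rewrite mulg1 len1 addn0.
have [q' [l' wq' e']] := accessible_mul acc e.
have [h1 /cone_typeE h2] := (type_mul q' wq).1 wq'.
exists (q * q')%g; rewrite mulgA; split=> //.
by rewrite h2; lia.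
Qed.

Lemma unbounded_fiber (F : finType) (f : W -> F) (Q : W -> Prop) :
  (forall n, exists2 w, (n <= len w)%N & Q w) ->
  exists a : F, forall n, exists2 w, (n <= len w)%N & Q w /\ f w = a.
Proof.
move=> unb; apply: contrapT => no.
have bad (a : F) : exists n, forall w, (n <= len w)%N -> Q w -> f w <> a.
  have /existsNP [n hn] : ~ forall n, exists2 w, (n <= len w)%N & Q w /\ f w = a.
    by move=> h; apply: no; exists a.
  by exists n => w nw Qw fw; apply: hn; exists w.
have [b hb] := choice bad.
have [w wn Qw] := unb (\max_(a : F) b a).
apply: (hb (f w) w) => //; apply: leq_trans wn.
exact: leq_bigmax.
Qed.

(** Infinitely many [w] of this type have inverses in the same position with respect
    to the finitely many lines that determine the type. *)
Lemma type_on_half_plane T : recurrent G T ->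
  exists de, [/\ root de, 0 < form base de &
    forall g, form (centre g) de < 0 -> cone_type c g^-1%g = T].
Proof.
move=> recT; have [E0 [rE test]] := finite_type_test.
pose f w := map_tuple (fun be => 0 < form (centre w^-1%g) be) (in_tuple E0).
have unb n : exists2 w, (n <= len w)%N & cone_type c w = T.
  have [w [q [_ nq /cone_typeE wq ->]]] := recurrent_unbounded n recT.
  by exists (w * q)%g; rewrite // wq (leq_trans nq) // leq_addl.
have [a ha] := unbounded_fiber f unb.
have [w0 _ [ew0 fw0]] := ha 0%N.
pose E := [seq if 0 < form (centre w0^-1%g) be then be else oppv be | be <- E0].
have rE' be : be \in E -> root be.
  case/mapP => ga /rE rg ->; case: ifP => // _; exact: root_oppv.
have agree w : f w = a -> {in E0, forall be,
    (0 < form (centre w^-1%g) be) = (0 < form (centre w0^-1%g) be)}.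
  by rewrite -fw0 => /(congr1 val) /= /eq_in_map.
have [n|de [rd pd sub]] := unbounded_contains_half_plane rE'.
  have [w nw [ew fw]] := ha n; exists w^-1%g; first by rewrite lenV.
  move=> _ /mapP [ga gE ->]; have := agree w fw ga gE; have rg := rE ga gE.
  case: ifP => [_ -> //|_ /negbT]; rewrite -leNgt => h.
  by rewrite formNr oppr_gt0; apply: centre_nonpos.
exists de; split=> // g /sub pos; rewrite -ew0; apply: test => be bE.
rewrite invgK; have := pos _ (map_f _ bE).
case: ifP => [_ -> //|_]; rewrite formNr oppr_gt0 => h.
by apply/negbTE; rewrite -leNgt ltW.
Qed.

(** The element [p] is chosen different from [1], so that [p^-1] lies outside its
    cone type; this fixes the side of the translated line on which [p^-1] lies. *)
Lemma recurrent_connected T T' : recurrent G T -> recurrent G T' -> T <> T' ->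
  accessible G T T'.
Proof.
move=> recT recT' ne.
have [p [eT p0]] : exists p, T = cone_type c p /\ (0 < len p)%N.
  have [w [q [_ lq /cone_typeE wq e]]] := recurrent_unbounded 1 recT.
  by exists (w * q)%g; rewrite wq addn_gt0 lq orbT.
have [de [rd pd type_de]] := type_on_half_plane recT'.
have [E [rE inE]] := type_half_planes p.
have [n|be [rb pb sub]] := unbounded_contains_half_plane rE.
  have [w [q [ew nq wq _]]] := recurrent_unbounded n recT.
  by exists q => //; apply/inE; rewrite -eT ew.
have [h hh] := translate_inside rb rd.
have ph : cone_type c p h.
  by apply/inE/sub/hh; rewrite centre_act mulVg centre1.
have e : T' = cone_type c (p * h)%g.
  rewrite -(type_de (p * h)^-1%g) ?invgK // invgM -centre_act.
  apply: centre_nonpos; first exact: root_act.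
  rewrite leNgt; apply/negP => /hh /sub /inE /cone_typeE.
  by rewrite mulgV len1 lenV; lia.
rewrite e eT; apply: mul_accessible => //.
by rewrite lt0n; apply/eqP => /len_eq0 h1; apply: ne; rewrite e eT h1 mulg1.
Qed.

Lemma accessible_recurrent T T' : accessible G T T' -> accessible G T' T ->
  accessible (recurrent_subgraph G) T T'.
Proof.
have vert T1 T2 : (exists s, edge G s T1 T2) -> vertices G T1 /\ vertices G T2.
  by case=> s [w [-> -> _]]; split; [exists w | exists (w * c s)%g].
elim=> {T T'} [T T' st|T T1 T' a1 ih1 a2 ih2] back.
  have [v v'] := vert _ _ st; case: (st) => s es.
  apply: t_step; exists s; split=> //; split=> //.
    by apply: t_trans back; apply: t_step.
  by apply: t_trans (t_step _ _ _ _ st); apply: back.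
by apply: t_trans (ih1 (t_trans _ _ _ _ _ a2 back)) (ih2 (t_trans _ _ _ _ _ back a1)).
Qed.

Theorem polygon_strongly_connected : strongly_connected G.
Proof.
move=> T T' recT recT' ne; apply: accessible_recurrent.
  exact: recurrent_connected.
by apply: recurrent_connected => // e; apply: ne.
Qed.

End Fuchsian.

(** * A polygon with prescribed angles *)

Section Polygon.
Variable R : realType.

Lemma pi_div_bounds (k : nat) : (2 <= k)%N ->
  0 < (pi : R) / k%:R <= pi / 2.
Proof.
move=> k2; have k0 : (0 : R) < k%:R by rewrite ltr0n; apply: leq_trans k2.
rewrite divr_gt0 ?pi_gt0 //= ler_wpM2l ?pi_ge0 // lef_pV2 ?posrE //.
by rewrite ler_nat.
Qed.

(** A polygon whose sides are all tangent to a circle splits into right-angled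
    kites; [a i] is half of the angle at the centre of the kite at the vertex [i],
    and [r] is the inverse of the hyperbolic cosine of the radius. The angles at
    the centre add up to more than a full turn when the radius tends to [0], by
    the assumption on the [k i], and to [0] when it tends to infinity. *)
Lemma half_angles (n : nat) (k : 'I_n -> nat) : (forall i, (2 <= k i)%N) ->
  \sum_(i < n) (k i)%:R^-1 < n%:R - 2 :> R ->
  exists (r : R) (a : 'I_n -> R), [/\ 0 < r < 1, \sum_i a i = pi &
    forall i, 0 < a i < pi / 2 /\ sin (a i) = r * cos (pi / (k i)%:R / 2)].
Proof.
move=> k2 hyper.
pose th i : R := pi / (k i)%:R / 2.
have thP i : 0 < th i <= pi / 4.
  by have := pi_div_bounds (k2 i); rewrite /th => /andP [? ?]; apply/andP; split; lra.
have pi0 : 0 < (pi : R) := pi_gt0 R.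
pose be i := cos (th i).
have be0 i : 0 < be i.
  by apply: cos_gt0_pihalf; have /andP [? ?] := thP i; apply/andP; split; lra.
have be1 i : be i < 1.
  rewrite /be -(cos0 R); have /andP [? ?] := thP i.
  by rewrite ltr_cos ?in_itv /=; [lra | apply/andP; split; lra | apply/andP; split; lra].
pose F (r : R) : R := \sum_i asin (r * be i).
have rb r i : 0 <= r <= 1 -> 0 <= r * be i < 1.
  move=> /andP [r0 r1]; rewrite mulr_ge0 //=; last exact: ltW.
  by have := be0 i; have := be1 i; nra.
have F0 : F 0 = 0.
  rewrite /F big1 // => i _; rewrite mul0r -[in asin 0](sin0 R) sinK //.
  by rewrite in_itv /=; apply/andP; split; lra.
have F1 : F 1 > pi.
  have -> : F 1 = pi / 2 * (n%:R - \sum_(i < n) (k i)%:R^-1).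
    rewrite /F mulrBr mulr_sumr.
    have -> : pi / 2 * n%:R = \sum_(i < n) pi / 2 :> R.
      by rewrite sumr_const card_ord mulr_natr.
    rewrite -sumrB; apply: eq_bigr => i _.
    rewrite mul1r /be -cosN -sinDpihalf addrC sinK; last first.
      by rewrite in_itv /=; have /andP [? ?] := thP i; apply/andP; split; lra.
    by rewrite /th; ring.
  by rewrite -subr_gt0; nra.
have [r r01 Fr] : exists2 r : R, r \in `[0, 1] & F r = pi.
  apply: (@IVT R F) => //; last first.
    rewrite F0 ge_min le_max (ltW F1) orbT andbT; apply/orP; left; exact: ltW.
  apply: continuous_in_subspaceT => r; rewrite inE /= in_itv /= => r01.
  have -> : F = \sum_i (fun r => asin (r * be i)).
    by apply/funext => x; rewrite fct_sumE.
  elim/big_ind: _ => [|f g cf cg|i _].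
  - exact: cst_continuous.
  - exact: continuousD.
  apply: (@continuous_comp R R R (fun x : R => x * be i) (@asin R) r).
    exact: mulrr_continuous.
  apply: continuous_asin; have /andP [? ?] := rb r i r01.
  by apply/andP; split; lra.
have r0 : 0 < r.
  move: r01; rewrite in_itv /= => /andP [r0 _]; rewrite lt_def r0 andbT.
  by apply/eqP => z; move: Fr; rewrite z F0; lra.
have r1 : r < 1.
  move: r01; rewrite in_itv /= => /andP [_ r1]; rewrite lt_def r1 andbT.
  by apply/eqP => z; move: Fr; rewrite -z; lra.
exists r, (fun i => asin (r * be i)); split=> [||i] //; first by rewrite r0.
have /andP [p1 p2] := rb r i ltac:(by rewrite !ltW).
have q0 : 0 < r * be i by rewrite mulr_gt0.
have ab : -1 <= r * be i <= 1 by apply/andP; split; lra.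
rewrite asinK ?in_itv //; split=> //.
rewrite asin_ltpi2 ?p2 ?andbT; last by lra.
rewrite ltNge; apply/negP => le0.
have : sin (asin (r * be i)) <= sin 0.
  rewrite leNgt ltr_sin ?in_itv /= -?leNgt //; last by rewrite asin_geNpi2 // asin_lepi2.
  by apply/andP; split; lra.
by rewrite asinK ?in_itv // sin0; lra.
Qed.

Lemma cheb_cos (t : R) n : cheb (cos t) n * sin t = sin (t *+ n).
Proof.
suff [] : cheb (cos t) n * sin t = sin (t *+ n) /\
          cheb (cos t) n.+1 * sin t = sin (t *+ n.+1) by [].
elim: n => [|n [h1 h2]]; first by rewrite mulr0n sin0 mul0r /= mul1r.
split=> //; rewrite chebSS.
have -> : t *+ n.+2 = t *+ n.+1 + t by rewrite mulrSr.
have e : t *+ n = t *+ n.+1 - t by rewrite mulrSr addrK.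
rewrite e sinB in h1; rewrite sinD -h2.
set C := cheb _ n.+1 in h2 *; set D := cheb _ n in h1 *.
have -> : (2 * cos t * C - D) * sin t = 2 * cos t * (C * sin t) - D * sin t by ring.
by rewrite h1 h2; ring.
Qed.

Lemma cheb_pi (k : nat) : (2 <= k)%N ->
  cheb (cos (pi / k%:R : R)) k = 0 /\
  forall j, (j <= k)%N -> 0 <= cheb (cos (pi / k%:R : R)) j.
Proof.
move=> k2; have /andP [t0 t1] := pi_div_bounds k2.
have k0 : (0 : R) < k%:R by rewrite ltr0n; apply: leq_trans k2.
set t := pi / _ in t0 t1 *.
have pi0 : 0 < (pi : R) := pi_gt0 R.
have tk : t *+ k = pi by rewrite -mulr_natr mulfVK // gt_eqF.
have s0 : 0 < sin t by apply: sin_gt0_pi; rewrite t0 /=; lra.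
split=> [|j jk].
  by apply/eqP; rewrite -(mulIr_eq0 _ (mulIf (lt0r_neq0 s0))) cheb_cos tk sinpi.
rewrite -(pmulr_lge0 _ s0) cheb_cos; apply: sin_ge0_pi.
by rewrite mulrn_wge0 ?(ltW t0) //= -tk ler_pMn2l.
Qed.

Lemma sin_between (b x : R) : 0 <= b -> b <= x -> x <= pi - b -> sin b <= sin x.
Proof.
have pi0 : 0 < (pi : R) := pi_gt0 R.
have mono y : 0 <= b -> b <= y -> y <= pi / 2 -> sin b <= sin y.
  move=> b0 h1 h2; rewrite leNgt ltr_sin ?in_itv /= -?leNgt //.
    by apply/andP; split; lra.
  by apply/andP; split; lra.
move=> b0 h1 h2; case: (leP x (pi / 2)) => h; first exact: mono.
have -> : sin x = sin (pi - x) by rewrite sinB sinpi cospi; ring.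
by apply: mono => //; lra.
Qed.

(** Two consecutive kites on both sides separate two sides of the polygon enough
    to keep them from crossing: the worst case is that of right angles. *)
Lemma two_kites (r x a1 a2 b1 b2 : R) : 0 < r < 1 ->
  (forall a, a \in [:: a1; a2; b1; b2] -> 0 < a < pi / 2 /\ r ^+ 2 / 2 <= sin a ^+ 2) ->
  a1 + a2 <= x -> x <= pi - (b1 + b2) -> r ^+ 2 <= sin x ^+ 2.
Proof.
have pi0 : 0 < (pi : R) := pi_gt0 R.
move=> /andP [r0 r1] H h1 h2.
pose h := Num.sqrt (2^-1 : R).
have h0 : 0 <= h := sqrtr_ge0 _.
have hh : h ^+ 2 = 2^-1 by rewrite sqr_sqrtr // invr_ge0.
have hr : 0 <= r * h <= 1 by rewrite mulr_ge0 ?ltW //=; nra.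
have ab : -1 <= r * h <= 1 by have /andP [? ?] := hr; apply/andP; split; lra.
(* half of the central angle of the kite at a right angle *)
pose b := asin (r * h).
have sb : sin b = r * h by rewrite asinK // in_itv.
have b_le : b <= pi / 2 by apply: asin_lepi2.
have b_ge : - (pi / 2) <= b by apply: asin_geNpi2.
have b0 : 0 <= b.
  rewrite leNgt -ltr_sin ?in_itv /= ?b_ge ?b_le //; last by apply/andP; split; lra.
  by rewrite sin0 sb -leNgt; case/andP: hr.
have small a : a \in [:: a1; a2; b1; b2] -> b <= a.
  move=> /H [/andP [p0 p1] ha]; rewrite leNgt -ltr_sin ?in_itv /= ?b_ge ?b_le //; last first.
    by apply/andP; split; lra.
  rewrite -leNgt sb -ler_sqr ?nnegrE; [by rewrite exprMn hh | by case/andP: hr |].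
  by apply: sin_ge0_pi; apply/andP; split; lra.
have s1 := small a1; have s2 := small a2; have s3 := small b1; have s4 := small b2.
rewrite !inE !eqxx ?orbT in s1 s2 s3 s4.
move: (s1 isT) (s2 isT) (s3 isT) (s4 isT) => {}s1 {}s2 {}s3 {}s4.
have sx : sin (b *+ 2) <= sin x.
  by apply: sin_between; rewrite mulr2n; lra.
have sq : r ^+ 2 <= sin (b *+ 2) ^+ 2.
  rewrite sin_mulr2n -mulr_natr !exprMn cos2sin2 sb exprMn hh.
  have u1 : r ^+ 2 <= 1 by nra.
  by have u0 := sqr_ge0 r; move: (r ^+ 2) u0 u1 => u *; nra.
apply: le_trans sq _; rewrite ler_sqr ?nnegrE //.
  by apply: sin_ge0_pi; rewrite mulr2n; apply/andP; split; lra.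
by apply: sin_ge0_pi; apply/andP; split; lra.
Qed.

Lemma half_polar (u v : R) : u ^+ 2 + v ^+ 2 = 1 ->
  exists2 p : R, 0 <= p < pi & u = cos (p *+ 2) /\ v = sin (p *+ 2).
Proof.
move=> uv; have pi0 : 0 < (pi : R) := pi_gt0 R.
have u1 : -1 <= u <= 1.
  rewrite -ler_norml -[_ <= 1]ler_sqr ?nnegrE // real_normK ?num_real // expr1n.
  by have := sqr_ge0 v; lra.
have c0 := acos_ge0 u1; have c1 := acos_lepi u1.
have cu : cos (acos u) = u by rewrite acosK // in_itv.
have su : sin (acos u) = `|v|.
  by rewrite sin_acos // -sqrtr_sqr; congr Num.sqrt; lra.
case: (leP 0 v) => v0.
  exists (acos u / 2); first by apply/andP; split; lra.
  have -> : acos u / 2 *+ 2 = acos u by rewrite mulr2n; lra.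
  by rewrite cu su ger0_norm.
exists (pi - acos u / 2).
  have : 0 < acos u by apply: acos_gt0; have /andP [-> _] := u1; rewrite /= ltNge; apply/negP => ?; nra.
  by move=> ?; apply/andP; split; lra.
have -> : (pi - acos u / 2) *+ 2 = - acos u + pi *+ 2 by rewrite !mulr2n; field.
by rewrite cosD2pi sinD2pi cosN sinN cu su ltr0_norm // opprK.
Qed.

Lemma sector (f : nat -> R) n x : f 0%N <= x -> x < f n ->
  exists2 j, (j < n)%N & f j <= x < f j.+1.
Proof.
move=> h0; elim: n => [|n IH] hn; first by have := le_lt_trans h0 hn; rewrite ltxx.
case: (ltP x (f n)) => h; last by exists n; rewrite // h hn.
by have [j jn hj] := IH h; exists j => //; apply: ltnW.
Qed.

Lemma cos_close (d a : R) : `|d *+ 2| <= a -> a <= pi -> cos a <= cos (d *+ 2).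
Proof.
move=> h1 h2; have d0 := normr_ge0 (d *+ 2).
rewrite -(cos_norm (d *+ 2)) leNgt ltr_cos ?in_itv /= -?leNgt //.
  by apply/andP; split; lra.
by apply/andP; split; lra.
Qed.
Lemma succ_angle n (a : 'I_n -> R) : \sum_i a i = pi ->
  let phi j := \sum_(i < n | (i < j)%N) a i in
  forall i : 'I_n, phi i.+1 = phi i + a i /\
    (phi (ordS i) = phi i.+1 \/ phi (ordS i) = phi i.+1 - pi).
Proof.
move=> sa phi i.
have step : phi i.+1 = phi i + a i.
  rewrite /phi (bigD1 i) //= addrC; congr (_ + _); apply: eq_bigl => j.
  by rewrite ltnS ltn_neqAle andbC -(inj_eq val_inj).
split=> //; have [lt|ge] := ltnP i.+1 n; first by left; rewrite /= modn_small.
have en : i.+1 = n by apply/eqP; rewrite eqn_leq ltn_ord ge.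
right; rewrite /= en modnn.
have -> : phi n = pi by rewrite -sa; apply: eq_bigl => j; rewrite ltn_ord.
by rewrite subrr; apply: big_pred0.
Qed.

Theorem polygon_exists (S : finType) (m : coxeter_matrix S) : fuchsian m ->
  exists alpha sigma eta, @lorentz_polygon R S m alpha sigma eta.
Proof.
case=> n [e [k [[n3 bij_e] k2 hyper adj nonadj]]].
have pi0 : 0 < (pi : R) := pi_gt0 R.
have hyperR : \sum_(i < n) (k i)%:R^-1 < n%:R - 2 :> R.
  move: hyper; rewrite -(ltr_rat R) rmorph_sum rmorphB /= !ratr_nat => h.
  apply: le_lt_trans h; rewrite le_eqVlt; apply/orP; left; apply/eqP.
  by apply: eq_bigr => i _; rewrite fmorphV /= ratr_nat.
have [r [a [r01 sa aP]]] := half_angles k2 hyperR.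
have /andP [r0 r1] := r01.
pose be i := cos (pi / (k i)%:R / 2 : R).
have beP i : 0 < be i /\ 2 * be i ^+ 2 = 1 + cos (pi / (k i)%:R).
  have /andP [t0 t1] := pi_div_bounds (k2 i); split.
    by apply: cos_gt0_pihalf; apply/andP; split; lra.
  have -> : pi / (k i)%:R = (pi / (k i)%:R / 2) *+ 2 :> R by rewrite mulr2n; lra.
  by rewrite cos_mulr2n -/(be i) -mulr_natr; ring.
have be12 i : 1 <= 2 * be i ^+ 2 < 2.
  have /andP [t0 t1] := pi_div_bounds (k2 i).
  rewrite (beP i).2; apply/andP; split.
    by rewrite lerDl; apply: cos_ge0_pihalf; apply/andP; split; lra.
  have : cos (pi / (k i)%:R) < cos 0 :> R.
    by rewrite ltr_cos ?in_itv /=; try (apply/andP; split); lra.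
  by rewrite cos0; lra.
have sa2 i : sin (a i) ^+ 2 = r ^+ 2 * be i ^+ 2 by rewrite (aP i).2 exprMn.
have aH i : 0 < a i < pi / 2 /\ r ^+ 2 / 2 <= sin (a i) ^+ 2.
  split; first exact: (aP i).1.
  by rewrite sa2; have /andP [h _] := be12 i; have := sqr_ge0 r; nra.
(* half of the direction in which side number [j] touches the circle *)
pose phi j := \sum_(i < n | (i < j)%N) a i.
have succ := succ_angle sa; rewrite -/phi in succ.
have phi0 : phi 0%N = 0 by apply: big_pred0.
have phin : phi n = pi by rewrite -sa; apply: eq_bigl => j; rewrite ltn_ord.
have phi_le i j : (i <= j)%N -> phi i <= phi j.
  move=> ij; rewrite /phi [leLHS]big_mkcond [leRHS]big_mkcond; apply: ler_sum => l _.
  have /andP [al _] := (aP l).1.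
  by case: ltnP => [li|_]; [rewrite (leq_trans li ij) | case: ifP => // _; apply: ltW].
(* the hyperbolic sine of the radius of the inscribed circle *)
pose sigma := Num.sqrt (r^-1 ^+ 2 - 1).
have ri : r * r^-1 = 1 by rewrite mulfV // gt_eqF.
have rr : r^-1 ^+ 2 * r ^+ 2 = 1 by rewrite -exprMn (mulrC _ r) ri expr1n.
have ri1 : 1 < r^-1 by rewrite invf_gt1.
have s2 : sigma ^+ 2 = r^-1 ^+ 2 - 1 by rewrite sqr_sqrtr //; nra.
have s0 : 0 < sigma by rewrite sqrtr_gt0; nra.
pose al i : vec R := (r^-1 * cos (phi (i : 'I_n) *+ 2), r^-1 * sin (phi i *+ 2), - sigma).
have alE i j : form (al i) (al j) = 1 - 2 * (r^-1 ^+ 2 * sin (phi i - phi j) ^+ 2).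
  have -> : form (al i) (al j) = r^-1 ^+ 2 * cos (phi i *+ 2 - phi j *+ 2) - sigma ^+ 2.
    by rewrite cosB /form /al /=; ring.
  by rewrite s2 -mulrnBl cos_mulr2n cos2sin2 -mulr_natr; ring.
have adjE i : form (al i) (al (ordS i)) = - cos (pi / (k i)%:R).
  have -> : form (al i) (al (ordS i)) = 1 - 2 * be i ^+ 2.
    rewrite alE; have -> : sin (phi i - phi (ordS i)) ^+ 2 = sin (a i) ^+ 2.
      have [e1 [e2|e2]] := succ i; rewrite e2 e1.
        by rewrite opprD addrA subrr add0r sinN sqrrN.
      have -> : phi i - (phi i + a i - pi) = - a i + pi by ring.
      by rewrite sinDpi sinN opprK.
    by rewrite sa2 (mulrA (r^-1 ^+ 2)) rr mul1r.
  by rewrite (beP i).2; ring.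
case: bij_e => e' eK e'K.
have far (i j : 'I_n) : (i < j)%N -> j != ordS i -> i != ordS j ->
    form (al i) (al j) <= -1.
  move=> ij ji nij; rewrite alE.
  have ij2 : (i.+1 < j)%N.
    rewrite ltn_neqAle ij andbT; apply/eqP => e1; move: ji.
    by rewrite -(inj_eq val_inj) /= modn_small ?e1 ?eqxx // ltn_ord.
  have i1n : (i.+1 < n)%N by apply: ltn_trans (ltn_ord j).
  pose i1 := Ordinal i1n.
  have h1 : a i + a i1 <= phi j - phi i.
    have := phi_le i.+2 j ij2; rewrite -[i.+2]/(i1.+1) (succ i1).1.
    by rewrite -[phi i1]/(phi i.+1) (succ i).1; lra.
  have [l h2] : exists l, phi j - phi i <= pi - (a j + a l).
    have [lt|ge] := ltnP j.+1 n.
      exists (Ordinal lt); have := phi_le j.+2 n lt; rewrite phin.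
      have := phi_le 0%N i isT; rewrite phi0.
      rewrite -[j.+2]/((Ordinal lt).+1) (succ (Ordinal lt)).1.
      by rewrite -[phi (Ordinal lt)]/(phi j.+1) (succ j).1; lra.
    have jn : j.+1 = n by apply/eqP; rewrite eqn_leq ltn_ord ge.
    have n0 : (0 < n)%N by apply: leq_trans n3.
    have i0 : (0 < i)%N.
      rewrite lt0n; apply/eqP => iz; move: nij.
      by rewrite -(inj_eq val_inj) /= jn modnn iz eqxx.
    exists (Ordinal n0); have := phi_le 1%N i i0.
    rewrite -[1%N]/((Ordinal n0).+1) (succ (Ordinal n0)).1 [phi (Ordinal n0)]phi0.
    by have := (succ j).1; rewrite jn phin; lra.
  have : r ^+ 2 <= sin (phi j - phi i) ^+ 2.
    apply: (two_kites r01 _ h1 h2) => b.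
    by rewrite !inE => /or4P [] /eqP ->; apply: aH.
  rewrite -(opprB (phi j)) sinN sqrrN => h.
  by have := sqr_ge0 r^-1; have := rr; nra.
have cP i : sigma < r^-1 * cos (a i).
  have c0 : 0 < cos (a i).
    by apply: cos_gt0_pihalf; have /andP [? ?] := (aP i).1; apply/andP; split; lra.
  rewrite -ltr_sqr ?nnegrE ?(ltW s0) //; last by apply: mulr_ge0; lra.
  rewrite s2 exprMn cos2sin2 sa2 mulrBr mulr1 (mulrA (r^-1 ^+ 2)) rr.
  by rewrite mul1r ltrD2l ltrN2; have /andP [_ ?] := be12 i; lra.
have n0 : (0 < n)%N by apply: leq_trans n3.
have [mu smu muP] : exists2 mu, sigma < mu & forall i, mu <= r^-1 * cos (a i).
  have [i _ hi] := @arg_minP _ _ _ (Ordinal n0) xpredT (fun i => r^-1 * cos (a i)) isT.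
  by exists (r^-1 * cos (a i)) => // j; apply: hi.
exists (al \o e'), sigma, mu; split=> //.
- by move=> s /=; rewrite alE subrr sin0; ring.
- by move=> s; rewrite form_base /al /= opprK.
- move=> s t K st; rewrite -(e'K s) -(e'K t) /= !eK => mst.
  have adjC i j : j = ordS i -> m (e i) (e j) = Some K ->
      - form (al i) (al j) = cos (pi / K%:R) /\ (2 <= K)%N.
    by move=> ->; rewrite adj => -[<-]; rewrite adjE opprK.
  have [-> K2] : - form (al (e' s)) (al (e' t)) = cos (pi / K%:R) /\ (2 <= K)%N.
    have [es|ns] := eqVneq (e' t) (ordS (e' s)); first exact: adjC.
    have [et|nt] := eqVneq (e' s) (ordS (e' t)).
      by rewrite formC; apply: adjC => //; rewrite cox_m_sym.
    by rewrite nonadj // in mst; rewrite (inj_eq (can_inj e'K)).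
  exact: cheb_pi.
- move=> s t st; rewrite -(e'K s) -(e'K t) /= !eK => mst.
  have [es|ns] := eqVneq (e' t) (ordS (e' s)); first by rewrite es adj in mst.
  have [et|nt] := eqVneq (e' s) (ordS (e' t)).
    by rewrite et cox_m_sym adj in mst.
  case: (ltngtP (e' s) (e' t)) => [lt|lt|/val_inj eq].
  + exact: far.
  + by rewrite formC; apply: far.
  + by move: st; rewrite -(e'K s) eq e'K eqxx.
move=> x; set nx := flat_norm x; have nx0 : 0 <= nx := flat_norm_ge0 x.
have nx2 : nx ^+ 2 = x.1.1 ^+ 2 + x.1.2 ^+ 2 := sqr_flat_norm x.
have [z|nz] := eqVneq nx 0.
  exists (e (Ordinal n0)); rewrite z mulr0.
  have [-> ->] : x.1.1 = 0 /\ x.1.2 = 0.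
    rewrite z expr0n /= in nx2.
    by split; apply/eqP; rewrite -sqrf_eq0 eq_le sqr_ge0 andbT; have := sqr_ge0 x.1.1; have := sqr_ge0 x.1.2; lra.
  by rewrite !mulr0 addr0.
have [|p /andP [p0 p1] [ep eq]] := @half_polar (x.1.1 / nx) (x.1.2 / nx).
  by rewrite !expr_div_n -mulrDl -nx2 mulfV // expf_neq0.
have x1 : x.1.1 = nx * cos (p *+ 2) by rewrite -ep mulrC mulfVK.
have x2 : x.1.2 = nx * sin (p *+ 2) by rewrite -eq mulrC mulfVK.
have [||j jn /andP [h1 h2]] := @sector phi n p; rewrite ?phi0 ?phin //.
pose i := Ordinal jn; have [si sj] := succ i.
have /andP [a0 a1] := (aP i).1.
have inner s : (al (e' s)).1.1 * x.1.1 + (al (e' s)).1.2 * x.1.2 =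
    r^-1 * nx * cos ((phi (e' s) - p) *+ 2).
  by rewrite mulrnBl cosB x1 x2 /al /=; ring.
suff [l hl] : exists l, cos (a i) <= cos ((phi (l : 'I_n) - p) *+ 2).
  exists (e l); rewrite inner eK; apply: le_trans (ler_wpM2r nx0 (muP i)) _.
  rewrite -!mulrA ler_wpM2l ?invr_ge0 ?(ltW r0) // mulrC ler_wpM2l //.
have [close|close] := leP (p - phi i) (a i / 2).
  exists i; apply: cos_close; last by lra.
  by rewrite mulr2n ler_norml -[phi i]/(phi j); apply/andP; split; lra.
rewrite -[phi i.+1]/(phi j.+1) in si sj; rewrite -[phi i]/(phi j) in si close.
have c1 : cos (a i) <= cos ((phi j.+1 - p) *+ 2).
  by apply: cos_close; [rewrite mulr2n ler_norml; apply/andP; split; lra | lra].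
exists (ordS i); case: sj => -> //.
have -> : (phi j.+1 - pi - p) *+ 2 = (phi j.+1 - p) *+ 2 - pi *+ 2.
  by rewrite !mulr2n; ring.
by rewrite -(cosD2pi (_ - _)) subrK.
Qed.

End Polygon.

(** * Strong connectedness *)

Theorem theorem3p2 (S : finType) (m : coxeter_matrix S) (W : groupType)
    (c : coxeter_system m W) (hF : fuchsian m) :
  strongly_connected (cannon_automaton c).
Proof.
have [alpha [sigma [eta P]]] := polygon_exists Rdefinitions.R hF.
exact: polygon_strongly_connected c _ _ _ _ P.
Qed.
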